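(* Let $\Omega$ be a locally compact space, $\varphi\colon\Omega\to\Omega$ a homeomorphism and $\Gamma$ and $\Lambda$ $\mathrm{U}_0(\Omega)$-normed modules. For $\mathcal{T}\in\mathscr{L}(\Gamma,\Lambda)$ the following are equivalent. (a) $\mathcal{T}(fs)=T_\varphi f\cdot\mathcal{T}s$ for every $f\in\mathrm{C}_0(\Omega)$ and $s\in\Gamma$. (b) $\mathrm{supp}(\mathcal{T}s)\subset\varphi(\mathrm{supp}(s))$ for every $s\in\Gamma$. (c) $|\mathcal{T}s|\le\|\mathcal{T}\|\cdot T_\varphi|s|$ for every $s\in\Gamma$. (d) There is $m>0$ such that $|\mathcal{T}s|\le m\cdot T_\varphi|s|$ for every $s\in\Gamma$. Moreover, if $\Gamma=\Gamma_0(E)$ and $\Lambda=\Gamma_0(F)$ for Banach bundles $E$ and $F$ over $\Omega$, then the properties (a)–(d) are also equivalent to the following assertion. (e) There is a Banach bundle morphism $\Phi\colon E\to F$ over $\varphi$ with $\mathcal{T}=\mathcal{T}_\Phi$. If (e) holds, then the morphism $\Phi$ in (e) is unique, $\|\Phi\|=\|\mathcal{T}\|$, and $\Phi$ is isometric if and only if $\mathcal{T}$ is isometric.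
   Context: All vector spaces are over a fixed field $\mathbb{K}\in\{\mathbb{R},\mathbb{C}\}$; locally compact spaces are Hausdorff; $\mathscr{L}$ denotes bounded linear maps; $\mathrm{C}_0(\Omega)$ is the algebra of continuous $\mathbb{K}$-valued functions vanishing at infinity. A Banach module over $\mathrm{C}_0(\Omega)$ is a Banach space $\Gamma$ which is a $\mathrm{C}_0(\Omega)$-module with $\|fs\|\le\|f\|\|s\|$; always assumed non-degenerate, i.e. $\Gamma=\overline{\mathrm{lin}}\{fs:f\in\mathrm{C}_0(\Omega),s\in\Gamma\}$. The support of $s\in\Gamma$ is $\mathrm{supp}(s)=\{x\in\Omega:\text{each }f\in\mathrm{C}_0(\Omega)\text{ with }f(x)\neq0\text{ satisfies }fs\ne0\}$. $\mathrm{U}_0(\Omega)$ is the set of upper semicontinuous $f\colon\Omega\to\mathbb{R}$ such that for every $\varepsilon>0$ there is a compact $L\subset\Omega$ with $|f(x)|\le\varepsilon$ for $x\notin L$; $\mathrm{U}_0(\Omega)_+=\{f\in\mathrm{U}_0(\Omega):f\ge0\}$ with the sup norm and the pointwise order. A $\mathrm{U}_0(\Omega)$-valued norm on a Banach module $\Gamma$ over $\mathrm{C}_0(\Omega)$ is a map $|\cdot|\colon\Gamma\to\mathrm{U}_0(\Omega)_+$ with (i) $\||s|\|=\|s\|$, (ii) $|fs|=|f|\cdot|s|$, (iii) $|s_1+s_2|\le|s_1|+|s_2|$ for all $s,s_1,s_2\in\Gamma$, $f\in\mathrm{C}_0(\Omega)$. A $\mathrm{U}_0(\Omega)$-normed module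 is a Banach module over $\mathrm{C}_0(\Omega)$ together with a $\mathrm{U}_0(\Omega)$-valued norm. $T_\varphi f=f\circ\varphi^{-1}$ for $f\in\mathrm{C}_0(\Omega)$ and for $f\in\mathrm{U}_0(\Omega)$. Banach bundle over $\Omega$: a pair $(E,p_E)$ of a topological space $E$ and a continuous, open, surjective map $p_E\colon E\to\Omega$ such that (i) each fiber $E_x=p_E^{-1}(x)$ is a Banach space; (ii) addition $E\times_\Omega E\to E$ (with $E\times_\Omega E=\bigcup_xE_x\times E_x\subset E\times E$, subspace topology) and scalar multiplication $\mathbb{K}\times E\to E$ are continuous; (iii) $v\mapsto\|v\|_{E_{p_E(v)}}$ is upper semicontinuous on $E$; (iv) for each $x\in\Omega$ and open $W\subset E$ containing the zero $0_x\in E_x$ there are $\varepsilon>0$ and an open neighborhood $U$ of $x$ with $\{v\in p_E^{-1}(U):\|v\|\le\varepsilon\}\subset W$. $\Gamma_0(E)$ is the space of continuous sections $s\colon\Omega\to E$ ($p_E\circ s=\mathrm{id}_\Omega$) such that for every $\varepsilon>0$ there is a compact $L$ with $\|s(x)\|\le\varepsilon$ for $x\notin L$, with norm $\sup_x\|s(x)\|$, operation $(fs)(x)=f(x)s(x)$ and $\mathrm{U}_0(\Omega)$-valued norm $|s|(x)=\|s(x)\|$. A Banach bundle morphism $\Phi\colon E\to F$ over $\varphi$ is a continuous map with $p_F\circ\Phi=\varphi\circ p_E$, $\Phi|_{E_x}\in\mathscr{L}(E_x,F_{\varphi(x)})$ for all $x$ and $\|\Phi\|:=\sup_x\|\Phi|_{E_x}\|<\infty$;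 it is isometric if each $\Phi|_{E_x}$ is an isometry. $\mathcal{T}_\Phi\in\mathscr{L}(\Gamma_0(E),\Gamma_0(F))$ is $\mathcal{T}_\Phi s=\Phi\circ s\circ\varphi^{-1}$. *)

(* Defs.v *)
From HB Require Import structures.
From mathcomp Require Import all_boot all_order all_algebra.
From mathcomp Require Import complex.
From mathcomp Require Import all_classical all_reals topology normedtype.

Set Implicit Arguments.
Unset Strict Implicit.
Unset Printing Implicit Defensive.

Import Order.TTheory GRing.Theory Num.Theory.
Import numFieldNormedType.Exports.

Local Open Scope classical_set_scope.
Local Open Scope ring_scope.

Lemma sup_range_ge0 (R : realType) (X : Type) (g : X -> R) :
  (forall x, 0 <= g x) -> 0 <= sup [set g x | x in [set: X]].
Proof.
move=> g0; have [[ne ub]|/sup_out->//] := pselect (has_sup (g @` [set: X])).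
have [_ [x _ _]] := ne; apply: le_trans (g0 x) _.
by apply: ub_le_sup => //; exists x.
Qed.

Variant scalar_kind := RealScalars | ComplexScalars.

Definition scalars (R : realType) (k : scalar_kind) : numFieldType :=
  match k with RealScalars => R | ComplexScalars => R[i] end.

(* Norms of [normedModType (scalars R k)] take their values in the scalar
   field; [real_part] brings these (nonnegative) values back into [R]. *)
Definition real_part (R : realType) (k : scalar_kind) : scalars R k -> R :=
  match k with RealScalars => idfun | ComplexScalars => @complex.Re R end.

Definition of_real (R : realType) (k : scalar_kind) : R -> scalars R k :=
  match k with RealScalars => idfun | ComplexScalars => real_complex R end.

Section scalars.
Context {R : realType} {k : scalar_kind}.
Local Notation K := (scalars R k).
Implicit Types (r s : R) (z w : K).

Lemma of_realK r : real_part (of_real k r) = r.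
Proof. by case: k. Qed.

Lemma real_partK z : 0 <= z -> of_real k (real_part z) = z.
Proof.
case: k z => //= z z0; apply: RRe_real; exact: ger0_real.
Qed.

Lemma ler_of_real r s : (of_real k r <= of_real k s) = (r <= s).
Proof. by case: k => //=; rewrite lecR. Qed.

Lemma of_realD r s : of_real k (r + s) = of_real k r + of_real k s.
Proof. by case: k => //=; rewrite rmorphD. Qed.

Lemma of_realM r s : of_real k (r * s) = of_real k r * of_real k s.
Proof. by case: k => //=; rewrite rmorphM. Qed.

Lemma of_real0 : of_real k (0 : R) = 0.
Proof. by case: k. Qed.

Lemma of_real1 : of_real k (1 : R) = 1.
Proof. by case: k. Qed.

Lemma of_real_inj : injective (@of_real R k).
Proof. by move=> r s /(congr1 (@real_part R k)); rewrite !of_realK. Qed.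

Lemma ltr_of_real r s : (of_real k r < of_real k s) = (r < s).
Proof.
rewrite !lt_neqAle ler_of_real; congr (~~ _ && _).
by apply/eqP/eqP => [/of_real_inj|->].
Qed.

Lemma norm_of_real r : `|of_real k r| = of_real k `|r|.
Proof. by case: k => //=; rewrite normc_def /= expr0n addr0 sqrtr_sqr. Qed.

Lemma of_realN r : of_real k (- r) = - of_real k r.
Proof. by case: k => //=; rewrite rmorphN. Qed.

Lemma of_real_continuous : continuous (@of_real R k).
Proof.
move=> r; apply/cvgrPdist_lt => e e0.
have e0' : (0 : R) < real_part e.
  by rewrite -ltr_of_real real_partK ?ltW// of_real0.
move/cvgrPdist_lt: (@cvg_id _ (nbhs r)) => /(_ _ e0').
apply: filterS => s rs.
by rewrite -of_realN -of_realD norm_of_real -(real_partK (ltW e0)) ltr_of_real.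
Qed.

End scalars.

Section rnorm.
Context {R : realType} {k : scalar_kind}.
Local Notation K := (scalars R k).

Definition rnorm (V : normedZmodType K) (v : V) : R := real_part `|v|.

Lemma of_real_rnorm (V : normedZmodType K) (v : V) : of_real k (rnorm v) = `|v|.
Proof. exact: real_partK. Qed.

Lemma rnorm_ge0 (V : normedZmodType K) (v : V) : 0 <= rnorm v.
Proof. by rewrite -(ler_of_real (k := k)) of_real_rnorm of_real0. Qed.

Lemma rnorm0 (V : normedZmodType K) : rnorm (0 : V) = 0.
Proof. by apply: (@of_real_inj _ k); rewrite of_real_rnorm normr0 of_real0. Qed.

Lemma rnorm_eq0 (V : normedZmodType K) (v : V) : rnorm v = 0 -> v = 0.
Proof.
by move=> v0; apply/normr0_eq0; rewrite -of_real_rnorm v0 of_real0.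
Qed.

Lemma rnormN (V : normedZmodType K) (v : V) : rnorm (- v) = rnorm v.
Proof. by rewrite /rnorm normrN. Qed.

Lemma rnormD (V : normedZmodType K) (v w : V) :
  rnorm (v + w) <= rnorm v + rnorm w.
Proof.
by rewrite -(ler_of_real (k := k)) of_realD !of_real_rnorm ler_normD.
Qed.

Lemma rnormZ (V : normedModType K) (a : K) (v : V) :
  rnorm (a *: v) = rnorm a * rnorm v.
Proof.
by apply: (@of_real_inj _ k); rewrite of_realM !of_real_rnorm normrZ.
Qed.

Lemma rnormM (a b : K) : rnorm (a * b) = rnorm a * rnorm b.
Proof.
by apply: (@of_real_inj _ k); rewrite of_realM !of_real_rnorm normrM.
Qed.

Lemma rnorm_of_real (r : R) : rnorm (of_real k r) = `|r|.
Proof. by apply: (@of_real_inj _ k); rewrite of_real_rnorm norm_of_real. Qed.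

Lemma rnorm_continuous (V : normedModType K) : continuous (@rnorm V).
Proof.
move=> v; apply/cvgrPdist_lt => e e0.
have e0' : (0 : K) < of_real k e by rewrite -of_real0 ltr_of_real.
move/cvgrPdist_lt: (@cvg_id _ (nbhs v)) => /(_ _ e0').
apply: filterS => w vw.
rewrite -(ltr_of_real (k := k)) -norm_of_real of_realD of_realN !of_real_rnorm.
exact: le_lt_trans (ler_dist_dist _ _) vw.
Qed.

Definition opnorm (V W : normedModType K) (f : V -> W) : R :=
  sup [set rnorm (f v) | v in [set v | rnorm v <= 1]].

Definition bounded_operator (V W : normedModType K) (f : V -> W) : Prop :=
  linear f /\ exists M : R, forall v, rnorm (f v) <= M * rnorm v.

Definition isometric (V W : normedModType K) (f : V -> W) : Prop :=
  forall v, rnorm (f v) = rnorm v.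

Definition lin_span (V : lmodType K) (A : set V) : set V :=
  [set v | exists (n : nat) (a : 'I_n -> K) (u : 'I_n -> V),
     (forall i, A (u i)) /\ v = \sum_(i < n) a i *: u i].

End rnorm.

Record lchType := LchType {
  lch_space :> topologicalType;
  lch_hausdorff : hausdorff_space lch_space;
  lch_locally_compact : locally_compact [set: lch_space] }.

Record homeomorphism (X Y : topologicalType) := Homeomorphism {
  homeo_fun :> X -> Y;
  homeo_inv : Y -> X;
  homeo_funK : cancel homeo_fun homeo_inv;
  homeo_invK : cancel homeo_inv homeo_fun;
  homeo_fun_continuous : continuous homeo_fun;
  homeo_inv_continuous : continuous homeo_inv }.

Arguments homeo_fun_continuous {X Y} _.
Arguments homeo_inv_continuous {X Y} _.

Section vanishing.
Context {R : realType} {X : topologicalType}.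
Implicit Types g h u : X -> R.

Definition vanishing g : Prop :=
  forall e : R, 0 < e ->
    exists2 L : set X, compact L & forall x, ~ L x -> g x <= e.

Definition upper_semicontinuous g : Prop :=
  forall a : R, open [set x | g x < a].

Definition U0 g : Prop :=
  upper_semicontinuous g /\ vanishing (fun x => `|g x|).

Definition U0_pos g : Prop := U0 g /\ forall x, 0 <= g x.

(* Here and in the other norms given as suprema over a space, the library's
   convention that the supremum of the empty set is 0 yields the expected norm
   when the space is empty. *)
Definition sup_norm g : R := sup [set `|g x| | x in [set: X]].

Lemma vanishing_le_add g h u : vanishing g -> vanishing h ->
  (forall x, u x <= g x + h x) -> vanishing u.
Proof.
move=> vg vh ugh e e0; have e2 : 0 < e / 2 by rewrite divr_gt0.
have [L cL gL] := vg _ e2; have [M cM hM] := vh _ e2.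
exists (L `|` M); first exact: compactU.
move=> x /not_orP[Lx Mx]; rewrite (le_trans (ugh x))// (splitr e).
by rewrite lerD ?gL ?hM.
Qed.

Lemma vanishing_le_scale g u c : 0 <= c -> vanishing g ->
  (forall x, u x <= c * g x) -> vanishing u.
Proof.
move=> c0 vg ucg e e0; have c1 : 0 < c + 1 by rewrite ltr_wpDl.
have [L cL gL] := vg _ (divr_gt0 e0 c1); exists L => // x Lx.
rewrite (le_trans (ucg x))// (le_trans (ler_wpM2l c0 (gL _ Lx)))//.
by rewrite mulrCA ler_piMr ?(ltW e0)// ler_pdivrMr// mul1r lerDl.
Qed.

Lemma usc_vanishing_bounded g : upper_semicontinuous g -> vanishing g ->
  exists M, forall x, g x <= M.
Proof.
move=> ug vg; have [L /compact_near_coveringP cL gL] := vg 1 ltr01.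
have := cL R (pinfty_nbhs R) (fun M x => g x < M) _.
have covL : forall x, L x ->
    \forall x' \near x & i \near pinfty_nbhs R, g x' < i.
  move=> x Lx; exists ([set y | g y < g x + 1], [set M | g x + 1 < M]).
    split=> /=; last by apply: nbhs_pinfty_gt; exact: num_real.
    by apply: open_nbhs_nbhs; split; [exact: ug|rewrite /= ltrDl].
  by move=> [y M] /= [gy /(lt_trans gy)].
move=> /(_ _ covL) Lnear.
have [M LM] : exists M, L `<=` [set x | g x < M].
  exact: filter_ex Lnear.
exists (Num.max M 1) => x; rewrite le_max.
by have [/LM/ltW->//|/gL ->] := pselect (L x); rewrite orbT.
Qed.

End vanishing.

Lemma vanishing_homeo (R : realType) (X Y : topologicalType)
  (phi : homeomorphism X Y) (g : X -> R) :
  vanishing g -> vanishing (g \o homeo_inv phi).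
Proof.
move=> vg e e0; have [L cL gL] := vg _ e0; exists (phi @` L).
  apply: continuous_compact => //; apply: continuous_subspaceT.
  exact: homeo_fun_continuous.
move=> y Ly; apply: gL => Ly'; apply: Ly; exists (homeo_inv phi y) => //.
exact: homeo_invK.
Qed.

Section C0.
Context {R : realType} {k : scalar_kind} {X : topologicalType}.
Local Notation K := (scalars R k).

Record C0 := MkC0 {
  C0_fun :> X -> K;
  C0_continuous : continuous C0_fun;
  C0_vanishing : vanishing (fun x => rnorm (C0_fun x)) }.

Lemma C0_ext (f g : C0) : f =1 g -> f = g.
Proof.
case: f g => [f cf vf] [g cg vg] /= /funext fg; subst g.
by rewrite (Prop_irrelevance cf cg) (Prop_irrelevance vf vg).
Qed.

HB.instance Definition _ := gen_eqMixin C0.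
HB.instance Definition _ := gen_choiceMixin C0.

Fact C0_zero_subproof : vanishing (fun _ : X => rnorm (0 : K)).
Proof.
by move=> e e0; exists set0 => [|x _]; [exact: compact0|rewrite rnorm0 ltW].
Qed.

Definition C0_zero : C0 := MkC0 (@cst_continuous X K 0) C0_zero_subproof.

Definition C0_add (f g : C0) : C0.
Proof.
apply: (@MkC0 (fun x => f x + g x)) => [x|].
  by apply: cvgD; exact: C0_continuous.
apply: vanishing_le_add (C0_vanishing f) (C0_vanishing g) _ => x.
exact: rnormD.
Defined.

Definition C0_scale (a : K) (f : C0) : C0.
Proof.
apply: (@MkC0 (fun x => a * f x)) => [x|].
  by apply: cvgM; [exact: cvg_cst|exact: C0_continuous].
apply: vanishing_le_scale (rnorm_ge0 a) (C0_vanishing f) _ => x.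
by rewrite rnormM.
Defined.

Definition C0_opp (f : C0) : C0 := C0_scale (- 1) f.

Lemma C0_bounded (f : C0) : exists M, forall x, rnorm (f x) <= M.
Proof.
apply: usc_vanishing_bounded (C0_vanishing f) => a.
rewrite (_ : mkset _ = (fun x => rnorm (f x)) @^-1` [set r | r < a])//.
apply: open_comp => [x _|]; last exact: open_lt.
apply: continuous_comp; first exact: C0_continuous.
exact: (@rnorm_continuous R k K^o).
Qed.

Definition C0_mul (f g : C0) : C0.
Proof.
apply: (@MkC0 (fun x => f x * g x)) => [x|].
  by apply: cvgM; exact: C0_continuous.
have [M fM] := C0_bounded f.
have M0 : 0 <= Num.max M 0 by rewrite le_max lexx orbT.
apply: vanishing_le_scale M0 (C0_vanishing g) _ => x.
by rewrite rnormM ler_wpM2r ?rnorm_ge0// le_max fM.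
Defined.

Fact C0_addA : associative C0_add.
Proof. by move=> f g h; apply: C0_ext => x /=; rewrite addrA. Qed.
Fact C0_addC : commutative C0_add.
Proof. by move=> f g; apply: C0_ext => x /=; rewrite addrC. Qed.
Fact C0_add0 : left_id C0_zero C0_add.
Proof. by move=> f; apply: C0_ext => x /=; rewrite add0r. Qed.
Fact C0_addN : left_inverse C0_zero C0_opp C0_add.
Proof. by move=> f; apply: C0_ext => x /=; rewrite mulN1r addNr. Qed.

HB.instance Definition _ :=
  GRing.isZmodule.Build C0 C0_addA C0_addC C0_add0 C0_addN.

Fact C0_scaleA a b f : C0_scale a (C0_scale b f) = C0_scale (a * b) f.
Proof. by apply: C0_ext => x /=; rewrite mulrA. Qed.
Fact C0_scale1 : left_id 1 C0_scale.
Proof. by move=> f; apply: C0_ext => x /=; rewrite mul1r. Qed.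
Fact C0_scaleDr : right_distributive C0_scale +%R.
Proof. by move=> a f g; apply: C0_ext => x /=; rewrite mulrDr. Qed.
Fact C0_scaleDl f : {morph C0_scale^~ f : a b / a + b}.
Proof. by move=> a b; apply: C0_ext => x /=; rewrite mulrDl. Qed.

HB.instance Definition _ := GRing.Zmodule_isLmodule.Build K C0
  C0_scaleA C0_scale1 C0_scaleDr C0_scaleDl.

Definition C0_norm (f : C0) : R := sup [set rnorm (f x) | x in [set: X]].

End C0.

Arguments C0 : clear implicits.
Arguments C0_continuous {R k X} _.

(* T_phi f on C_0; on U_0 it is the plain composition with phi^-1. *)
Definition C0_transport (R : realType) (k : scalar_kind) (X : topologicalType)
  (phi : homeomorphism X X) (f : C0 R k X) : C0 R k X.
Proof.
apply: (@MkC0 R k X (f \o homeo_inv phi)) => [x|].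
  apply: continuous_comp; first exact: homeo_inv_continuous.
  exact: C0_continuous.
exact: (vanishing_homeo phi (C0_vanishing f)).
Defined.

Section modules.
Context (R : realType) (k : scalar_kind) (X : topologicalType).
Local Notation K := (scalars R k).
Local Notation C0 := (C0 R k X).

Record banach_module := BanachModule {
  bm_space :> completeNormedModType K;
  bm_act : C0 -> bm_space -> bm_space;
  bm_actDl : forall f g s, bm_act (f + g) s = bm_act f s + bm_act g s;
  bm_actDr : forall f s t, bm_act f (s + t) = bm_act f s + bm_act f t;
  bm_actZl : forall (a : K) f s, bm_act (a *: f) s = a *: bm_act f s;
  bm_actZr : forall (a : K) f s, bm_act f (a *: s) = a *: bm_act f s;
  bm_actM : forall f g s, bm_act (C0_mul f g) s = bm_act f (bm_act g s);
  bm_act_norm : forall f s, rnorm (bm_act f s) <= C0_norm f * rnorm s;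
  bm_nondegenerate :
    closure (lin_span [set bm_act f s | f in setT & s in setT]) = setT }.

Definition supp (M : banach_module) (s : M) : set X :=
  [set x | forall f : C0, f x != 0 -> bm_act f s != 0].

Record U0_normed_module := U0NormedModule {
  um_module :> banach_module;
  um_norm : um_module -> X -> R;
  um_norm_U0 : forall s, U0_pos (um_norm s);
  um_norm_sup : forall s, sup_norm (um_norm s) = rnorm s;
  um_norm_act : forall f s x,
    um_norm (bm_act f s) x = rnorm (f x) * um_norm s x;
  um_normD : forall s t x, um_norm (s + t) x <= um_norm s x + um_norm t x }.

End modules.

Lemma pair_continuous (X Y Z : topologicalType) (f : X -> Y) (g : X -> Z) :
  continuous f -> continuous g -> continuous (fun x => (f x, g x)).
Proof. by move=> cf cg x; exact: cvg_pair (cf x) (cg x). Qed.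

Section bundles.
Context {R : realType} {k : scalar_kind}.
Local Notation K := (scalars R k).

(* A family of Banach spaces together with a topology on the disjoint union of
   its members.  Presenting the total space E as {x & E_x}, with p_E the first
   projection, makes p_E^-1(x) the Banach space E_x by construction. *)
Record bundle_data (X : topologicalType) := BundleData {
  fiber :> X -> completeNormedModType K;
  bundle_open : set (set {x & fiber x});
  bundle_openT : bundle_open setT;
  bundle_openI : setI_closed bundle_open;
  bundle_open_bigU : forall (I : Type) (f : I -> set {x & fiber x}),
    (forall i, bundle_open (f i)) -> bundle_open (\bigcup_i f i) }.

Definition total_space (X : topologicalType) (E : bundle_data X) : Type :=
  {x & E x}.

HB.instance Definition _ (X : topologicalType) (E : bundle_data X) :=
  Choice.on (total_space E).
HB.instance Definition _ (X : topologicalType) (E : bundle_data X) :=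
  isOpenTopological.Build (total_space E)
    (@bundle_openT X E) (@bundle_openI X E) (@bundle_open_bigU X E).

Section total.
Context {X : topologicalType}.
Implicit Type E : bundle_data X.

Definition in_fiber E (x : X) (v : E x) : total_space E := existT _ x v.

Definition bundle_proj E (v : total_space E) : X := projT1 v.

Definition bundle_norm E (v : total_space E) : R := rnorm (projT2 v).

(* E x_X E as the disjoint union of the E_x x E_x, with the topology induced
   by its inclusion into E x E. *)
Definition fiber_square E : Type := {x & (E x * E x)%type}.

HB.instance Definition _ E := Choice.on (fiber_square E).

Definition fiber_square_incl E (w : fiber_square E) :
    total_space E * total_space E :=
  (in_fiber (projT2 w).1, in_fiber (projT2 w).2).

Definition fiber_add E (w : initial_topology (@fiber_square_incl E)) :
  total_space E := in_fiber ((projT2 w).1 + (projT2 w).2).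

Definition fiber_scale E (p : K * total_space E) : total_space E :=
  in_fiber (p.1 *: projT2 p.2).

Definition section_map E (s : forall x, E x) : X -> total_space E :=
  fun x => in_fiber (s x).

End total.

Record banach_bundle (X : topologicalType) := BanachBundle {
  bb_data :> bundle_data X;
  bb_proj_continuous : continuous (@bundle_proj X bb_data);
  bb_proj_open : forall A : set (total_space bb_data),
    open A -> open (@bundle_proj X bb_data @` A);
  bb_proj_surj : forall x, exists v, @bundle_proj X bb_data v = x;
  bb_add_continuous : continuous (@fiber_add X bb_data);
  bb_scale_continuous : continuous (@fiber_scale X bb_data);
  bb_norm_usc : upper_semicontinuous (@bundle_norm X bb_data);
  bb_zero_nbhs : forall (x : X) (W : set (total_space bb_data)),
    open W -> W (in_fiber (0 : bb_data x)) ->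
    exists2 e : R, 0 < e & exists U : set X, [/\ open U, U x &
      forall v : total_space bb_data,
        U (bundle_proj v) -> bundle_norm v <= e -> W v] }.

Record C0_section (X : topologicalType) (E : banach_bundle X) := MkC0Section {
  sec_fun :> forall x, E x;
  sec_continuous : continuous (section_map sec_fun);
  sec_vanishing : vanishing (fun x => rnorm (sec_fun x)) }.

End bundles.

Arguments bb_proj_continuous {R k X} _.
Arguments bb_add_continuous {R k X} _.
Arguments bb_scale_continuous {R k X} _.
Arguments sec_continuous {R k X E} _.

Section C0_section_lmodule.
Context {R : realType} {k : scalar_kind} {X : topologicalType}
  (E : banach_bundle (R := R) (k := k) X).
Local Notation K := (scalars R k).
Local Notation S := (C0_section E).
Implicit Types s t : S.

Lemma C0_section_ext s t : (forall x, s x = t x) -> s = t.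
Proof.
case: s t => [s cs vs] [t ct vt] /= eq_st.
have st : s = t by exact: functional_extensionality_dep.
subst t.
by rewrite (Prop_irrelevance cs ct) (Prop_irrelevance vs vt).
Qed.

HB.instance Definition _ := gen_eqMixin S.
HB.instance Definition _ := gen_choiceMixin S.

Lemma zero_near (x : X) (W : set (total_space E)) :
  nbhs (in_fiber (0 : E x)) W ->
  exists2 e : R, 0 < e & \forall y \near x,
    forall v : E y, rnorm v <= e -> W (in_fiber v).
Proof.
rewrite nbhsE => -[V [oV V0] VW].
have [e e0 [U [oU Ux UV]]] := bb_zero_nbhs oV V0; exists e => //.
apply: (@filterS _ _ _ U); last exact: open_nbhs_nbhs.
by move=> y Uy v ve; apply/VW/UV.
Qed.

Fact zero_sec_continuous : continuous (section_map (fun x => 0 : E x)).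
Proof.
move=> x W /zero_near[e e0]; apply: filterS => y /(_ 0); apply.
by rewrite rnorm0 ltW.
Qed.

Fact zero_sec_vanishing : vanishing (fun x => rnorm (0 : E x)).
Proof.
by move=> e e0; exists set0 => [|x _]; [exact: compact0|rewrite rnorm0 ltW].
Qed.

Definition zero_sec : S := MkC0Section zero_sec_continuous zero_sec_vanishing.

Fact add_sec_continuous s t :
  continuous (section_map (fun x => s x + t x)).
Proof.
pose w (x : X) : initial_topology (@fiber_square_incl _ _ X E) :=
  existT _ x (s x, t x).
have cw : continuous w.
  apply/continuousP => A [B oB <-].
  have cst : continuous (fun x => (section_map s x, section_map t x)).
    exact: pair_continuous (sec_continuous s) (sec_continuous t).
  by move/continuousP: cst => /(_ B oB).
move=> x; apply: (@continuous_comp _ _ _ w (@fiber_add _ _ X E)).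
  exact: cw.
exact: bb_add_continuous.
Qed.

Fact add_sec_vanishing s t : vanishing (fun x => rnorm (s x + t x)).
Proof.
apply: vanishing_le_add (sec_vanishing s) (sec_vanishing t) _ => x.
exact: rnormD.
Qed.

Definition add_sec s t : S :=
  MkC0Section (@add_sec_continuous s t) (@add_sec_vanishing s t).

Fact mul_sec_continuous (f : X -> K) s : continuous f ->
  continuous (section_map (fun x => f x *: s x)).
Proof.
move=> cf x; apply: (@continuous_comp _ _ _
  (fun x => (f x, section_map s x)) (@fiber_scale _ _ X E)).
  exact: pair_continuous cf (sec_continuous s) x.
exact: bb_scale_continuous.
Qed.

Fact mul_sec_vanishing (f : X -> K) s M : (forall x, rnorm (f x) <= M) ->
  vanishing (fun x => rnorm (f x *: s x)).
Proof.
move=> fM; have M0 : 0 <= Num.max M 0 by rewrite le_max lexx orbT.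
apply: vanishing_le_scale M0 (sec_vanishing s) _ => x.
by rewrite rnormZ ler_wpM2r ?rnorm_ge0// le_max fM.
Qed.

Definition scale_sec (a : K) s : S :=
  MkC0Section (@mul_sec_continuous _ s (@cst_continuous X K a))
    (@mul_sec_vanishing _ s _ (fun _ : X => lexx (rnorm a))).

Definition opp_sec s : S := scale_sec (- 1) s.

Fact add_secA : associative add_sec.
Proof. by move=> r s t; apply: C0_section_ext => x /=; rewrite addrA. Qed.
Fact add_secC : commutative add_sec.
Proof. by move=> s t; apply: C0_section_ext => x /=; rewrite addrC. Qed.
Fact add_sec0 : left_id zero_sec add_sec.
Proof. by move=> s; apply: C0_section_ext => x /=; rewrite add0r. Qed.
Fact add_secN : left_inverse zero_sec opp_sec add_sec.
Proof.
by move=> s; apply: C0_section_ext => x /=; rewrite scaleN1r addNr.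
Qed.

HB.instance Definition _ :=
  GRing.isZmodule.Build S add_secA add_secC add_sec0 add_secN.

Fact scale_secA a b s : scale_sec a (scale_sec b s) = scale_sec (a * b) s.
Proof. by apply: C0_section_ext => x /=; rewrite scalerA. Qed.
Fact scale_sec1 : left_id 1 scale_sec.
Proof. by move=> s; apply: C0_section_ext => x /=; rewrite scale1r. Qed.
Fact scale_secDr : right_distributive scale_sec +%R.
Proof. by move=> a s t; apply: C0_section_ext => x /=; rewrite scalerDr. Qed.
Fact scale_secDl s : {morph scale_sec^~ s : a b / a + b}.
Proof. by move=> a b; apply: C0_section_ext => x /=; rewrite scalerDl. Qed.

HB.instance Definition _ := GRing.Zmodule_isLmodule.Build K S
  scale_secA scale_sec1 scale_secDr scale_secDl.

Lemma sec_usc s : upper_semicontinuous (fun x => rnorm (s x)).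
Proof.
move=> a.
rewrite (_ : mkset _ = section_map s @^-1` [set v | bundle_norm v < a])//.
by apply: open_comp => [x _|]; [exact: sec_continuous|exact: bb_norm_usc].
Qed.

Lemma sec_bounded s : exists M, forall x, rnorm (s x) <= M.
Proof. exact: usc_vanishing_bounded (sec_usc s) (sec_vanishing s). Qed.

Definition sec_norm s : R := sup [set rnorm (s x) | x in [set: X]].

Lemma le_sec_norm s x : rnorm (s x) <= sec_norm s.
Proof.
have [M sM] := sec_bounded s; apply: ub_le_sup; last by exists x.
by exists M => _ [y _ <-].
Qed.

Lemma sec_norm_le s M : 0 <= M -> (forall x, rnorm (s x) <= M) ->
  sec_norm s <= M.
Proof.
move=> M0 sM; rewrite /sec_norm.
have [->|ne] := pselect ([set rnorm (s x) | x in [set: X]] = set0).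
  by rewrite sup0.
by apply: ge_sup; [exact/set0P/eqP|move=> _ [x _ <-]].
Qed.

Lemma sec_norm_ge0 s : 0 <= sec_norm s.
Proof. by apply: sup_range_ge0 => x; exact: rnorm_ge0. Qed.

Fact sec_normD s t : of_real k (sec_norm (s + t)) <=
  of_real k (sec_norm s) + of_real k (sec_norm t).
Proof.
rewrite -of_realD ler_of_real sec_norm_le// ?addr_ge0 ?sec_norm_ge0// => x.
by rewrite (le_trans (rnormD _ _))// lerD ?le_sec_norm.
Qed.

Fact sec_normZ (a : K) s :
  of_real k (sec_norm (a *: s)) = `|a| * of_real k (sec_norm s).
Proof.
rewrite -(@of_real_rnorm R k K a) -of_realM; congr of_real.
have le (b : K) t : sec_norm (b *: t) <= rnorm b * sec_norm t.
  apply: sec_norm_le => [|x].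
    by rewrite mulr_ge0 ?rnorm_ge0 ?sec_norm_ge0.
  by rewrite rnormZ ler_wpM2l ?rnorm_ge0 ?le_sec_norm.
apply/le_anti; rewrite le/=.
have [->|a0] := eqVneq a 0; first by rewrite rnorm0 mul0r sec_norm_ge0.
have ra0 : 0 < rnorm a.
  rewrite lt_neqAle rnorm_ge0 andbT eq_sym; apply: contra_neq a0.
  exact: rnorm_eq0.
rewrite -ler_pdivlMl//; have := le a^-1 (a *: s).
rewrite scalerA mulVf// scale1r => /le_trans; apply.
rewrite ler_wpM2r ?sec_norm_ge0//.
suff -> : rnorm a^-1 = (rnorm a)^-1 by [].
apply: (mulfI (lt0r_neq0 ra0)); rewrite -rnormM divff// divff ?lt0r_neq0//.
by rewrite -of_real1 rnorm_of_real normr1.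
Qed.

Fact sec_norm_eq0 s : of_real k (sec_norm s) = 0 -> s = 0.
Proof.
rewrite -of_real0 => /of_real_inj s0; apply: C0_section_ext => x.
by apply/rnorm_eq0/le_anti; rewrite rnorm_ge0 -{1}s0 le_sec_norm.
Qed.

HB.instance Definition _ := Lmodule_isNormed.Build K S
  sec_normD sec_normZ sec_norm_eq0.

Lemma rnorm_sec s : rnorm s = sec_norm s.
Proof. exact: of_realK. Qed.

End C0_section_lmodule.

Section C0_section_complete.
Context {R : realType} {k : scalar_kind} {X : topologicalType}
  (E : banach_bundle (R := R) (k := k) X).
Local Notation K := (scalars R k).
Local Notation S := (C0_section E).

Lemma add_near (x : X) (v : E x) (W : set (total_space E)) :
  nbhs (in_fiber v) W ->
  exists2 V : set (total_space E), nbhs (in_fiber v) V &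
  exists2 e : R, 0 < e & \forall y \near x, forall a b : E y,
    V (in_fiber a) -> rnorm b <= e -> W (in_fiber (a + b)).
Proof.
move=> vW.
pose w0 : initial_topology (@fiber_square_incl _ _ X E) :=
  existT _ x (v, 0).
have : nbhs (fiber_add w0) W by rewrite /fiber_add /= addr0.
move/(bb_add_continuous E w0); rewrite /= nbhs_filterE nbhsE.
move=> -[_ [[B oB <-] Bw0] BW].
have [[V Z] /= [vV zZ] VZB] : nbhs (in_fiber v, in_fiber (0 : E x)) B.
  by apply: open_nbhs_nbhs; split.
have [e e0 xZ] := zero_near zZ.
exists V => //; exists e => //; apply: filterS xZ => y yZ a b Va be.
by apply: (BW (existT _ y (a, b))); apply: VZB; split => //=; exact: yZ.
Qed.

Lemma sec_lim_continuous (l : forall x, E x) :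
  (forall e : R, 0 < e -> exists t : S, forall x, rnorm (l x - t x) <= e) ->
  continuous (section_map l).
Proof.
move=> lim_l x W /add_near[V xV [e e0 xW]].
have /add_near[V' xV' [e' e'0 /nbhs_singleton xV'V]] := nbhs_interior xV.
have m0 : 0 < Num.min e e' by rewrite lt_min e0.
have [t lt] := lim_l _ m0.
have tV : nbhs (section_map t x) V.
  have := xV'V (l x) (t x - l x) (nbhs_singleton xV').
  rewrite /= subrKC; apply; rewrite -rnormN opprB.
  by rewrite (le_trans (lt x))// ge_min lexx orbT.
have := sec_continuous t x V tV; rewrite /= nbhs_filterE => yV.
apply: filterS2 xW yV => y yW tyV.
have := yW (t y) (l y - t y) tyV; rewrite subrKC; apply.
by rewrite (le_trans (lt y))// ge_min lexx.
Qed.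

Lemma sec_lim_vanishing (l : forall x, E x) :
  (forall e : R, 0 < e -> exists t : S, forall x, rnorm (l x - t x) <= e) ->
  vanishing (fun x => rnorm (l x)).
Proof.
move=> lim_l e e0; have e2 : 0 < e / 2 by rewrite divr_gt0.
have [t lt] := lim_l _ e2; have [L cL tL] := sec_vanishing t e2.
exists L => // x Lx; rewrite -(subrK (t x) (l x)) (le_trans (rnormD _ _))//.
by rewrite (splitr e) lerD ?lt ?tL.
Qed.

Lemma ballP (V : normedModType K) (v w : V) (e : R) :
  ball v (of_real k e) w <-> rnorm (v - w) < e.
Proof.
by rewrite -ball_normE /ball_ /= -of_real_rnorm ltr_of_real.
Qed.

Lemma cauchy_rnormP (V : normedModType K) (F : set_system V) : Filter F ->
  cauchy F <-> forall e : R, 0 < e ->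
    exists2 A, F A & forall v w, A v -> A w -> rnorm (v - w) < e.
Proof.
move=> FF; rewrite -cauchy_ballP; split=> [Fc e e0|Fc e e0].
  have e0' : 0 < of_real k e by rewrite -of_real0 ltr_of_real.
  have [[P Q] /= [FP FQ] PQ] := Fc _ e0'.
  exists (P `&` Q); first exact: filterI.
  by move=> v w [Pv _] [_ Qw]; apply/ballP; apply: (PQ (v, w)).
have e0' : 0 < real_part e.
  by rewrite -(ltr_of_real (k := k)) real_partK ?ltW// of_real0.
have [A FA Ae] := Fc _ e0'; exists (A, A) => // -[v w] /= [Av Aw].
by rewrite -(real_partK (ltW e0)); apply/ballP/Ae.
Qed.

Lemma cvg_rnormP (V : normedModType K) (F : set_system V) (l : V) : Filter F ->
  F --> l <-> forall e : R, 0 < e -> F [set v | rnorm (l - v) < e].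
Proof.
move=> FF; split=> [/cvg_ballP Fl e e0|Fl].
  have e0' : 0 < of_real k e by rewrite -of_real0 ltr_of_real.
  by apply: filterS (Fl _ e0') => v /ballP.
apply/cvg_ballP => e e0.
have e0' : 0 < real_part e.
  by rewrite -(ltr_of_real (k := k)) real_partK ?ltW// of_real0.
apply: filterS (Fl _ e0') => v lv.
by rewrite -(real_partK (ltW e0)); apply/ballP.
Qed.

Fact sec_complete (F : set_system S) : ProperFilter F -> cauchy F -> cvg F.
Proof.
move=> FF /cauchy_rnormP Fc.
pose G x : set_system (E x) := (fun s : S => s x) @ F.
have lesx (s t : S) (x : X) : rnorm (s x - t x) <= rnorm (s - t).
  have := le_sec_norm (s - t) x; rewrite -rnorm_sec /=.
  by rewrite scaleN1r.
have Gc x : cauchy (G x).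
  apply/cauchy_rnormP => e /Fc[A FA Ae].
  exists ((fun s : S => s x) @` A).
    rewrite /G /= nbhs_filterE.
    by apply: (@filterS _ F _ A) => // s As; exists s.
  move=> _ _ [s As <-] [t At <-].
  exact: le_lt_trans (lesx _ _ _) (Ae _ _ As At).
pose l x : E x := lim (G x).
have FG x : ProperFilter (G x) by exact: fmap_proper_filter.
have Gl x : G x --> l x := @cauchy_cvg (E x) (G x) (FG x) (Gc x).
have unif (e : R) : 0 < e -> exists2 A, F A &
    forall t, A t -> forall x, rnorm (l x - t x) <= e.
  move=> /Fc[A FA Ae]; exists A => // t At x; apply/ler_addgt0Pr => d d0.
  have /cvg_rnormP /(_ _ d0) Fd := Gl x.
  have Fs : F [set s : S | rnorm (l x - s x) < d] by [].
  have [s [As /= sd]] := filter_ex (filterI FA Fs).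
  rewrite -(subrKA (s x)) (le_trans (rnormD _ _))// addrC lerD ?(ltW sd)//.
  exact: le_trans (lesx _ _ _) (ltW (Ae _ _ As At)).
have lim_l (e : R) : 0 < e ->
    exists t : S, forall x, rnorm (l x - t x) <= e.
  by move=> /unif[A /filter_ex[t At] Ae]; exists t; exact: Ae.
pose L : S := MkC0Section (sec_lim_continuous lim_l) (sec_lim_vanishing lim_l).
apply/cvg_ex; exists L; apply/cvg_rnormP => e e0.
have e2 : 0 < e / 2 by rewrite divr_gt0.
have [A FA Ae] := unif _ e2; apply: filterS FA => t At /=.
rewrite rnorm_sec (@le_lt_trans _ _ (e / 2))//; last first.
  by rewrite ltr_pdivrMr// ltr_pMr// ltr1n.
apply: sec_norm_le (ltW e2) _ => x /=; rewrite scaleN1r; exact: Ae.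
Qed.

HB.instance Definition _ := Uniform_isComplete.Build S sec_complete.

End C0_section_complete.

Section Gamma0.
Context {R : realType} {k : scalar_kind} {X : lchType}
  (E : banach_bundle (R := R) (k := k) X).
Local Notation K := (scalars R k).
Local Notation C0 := (C0 R k X).
Local Notation S := (C0_section E).

Lemma C0_urysohn (L : set X) : compact L ->
  exists f : C0, forall x, rnorm (1 - f x) <= 1 /\ (L x -> f x = 1).
Proof.
move=> cL; pose opc := one_point_compactification X.
have hopc : hausdorff_space opc.
  apply: one_point_compactification_hausdorff.
    exact: lch_locally_compact.
  exact: lch_hausdorff.
have nopc : normal_space opc.
  exact: compact_normal hopc one_point_compactification_compact.
have clL : closed (Some @` L : set opc).
  apply: compact_closed hopc _; apply: continuous_compact cL.
  apply: continuous_subspaceT.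
  exact: one_point_compactification_some_continuous.
have clN : closed [set None : opc].
  exact/accessible_closed_set1/hausdorff_accessible.
have LN : Some @` L `&` [set None : opc] = set0.
  by rewrite -subset0 => _ [[x _ <-]].
have /(@uniform_separatorP _ R)[g [cg g01 gL gN]] :=
  (@normal_separatorP R _).1 nopc _ _ clL clN LN.
have cgS : continuous (fun x : X => g (Some x)).
  move=> x; apply: (@continuous_comp X opc R Some g); last exact: cg.
  exact: one_point_compactification_some_continuous.
have g01' x : 0 <= g (Some x) <= 1.
  by have := g01 (g (Some x)); rewrite /= in_itv /=; apply; exists (Some x).
have cf : continuous (fun x : X => of_real k (1 - g (Some x))).
  move=> x; apply: (@continuous_comp _ _ _ (fun x : X => 1 - g (Some x))).
    by apply: cvgB; [exact: cvg_cst|exact: cgS].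
  exact: of_real_continuous.
have vf : vanishing (fun x : X => rnorm (of_real k (1 - g (Some x)))).
  move=> e e0; have gN1 : g None = 1 by apply: gN; exists None.
  have /cvgrPdist_lt/(_ _ e0) := cg None; rewrite gN1.
  case=> C [cC _] Ce; exists C => // x Cx.
  by rewrite rnorm_of_real ltW//; apply: (Ce (Some x)); left; exists x.
exists (MkC0 cf vf) => x; split=> [|Lx] /=.
  rewrite -[1 as X in X - _](@of_real1 R k) -of_realN -of_realD rnorm_of_real.
  by have /andP[? ?] := g01' x; rewrite opprB addrC subrK ger0_norm.
rewrite (_ : g (Some x) = 0) ?subr0 ?of_real1//.
by apply: gL; exists (Some x) => //; exists x.
Qed.

Definition sec_act (f : C0) (s : S) : S :=
  MkC0Section (@mul_sec_continuous _ _ _ _ _ s (C0_continuous f))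
    (mul_sec_vanishing s (projT2 (cid (C0_bounded f)))).

Fact sec_actDl f g s : sec_act (f + g) s = sec_act f s + sec_act g s.
Proof. by apply: C0_section_ext => x /=; rewrite scalerDl. Qed.
Fact sec_actDr f s t : sec_act f (s + t) = sec_act f s + sec_act f t.
Proof. by apply: C0_section_ext => x /=; rewrite scalerDr. Qed.
Fact sec_actZl (a : K) f s : sec_act (a *: f) s = a *: sec_act f s.
Proof. by apply: C0_section_ext => x /=; rewrite scalerA. Qed.
Fact sec_actZr (a : K) f s : sec_act f (a *: s) = a *: sec_act f s.
Proof. by apply: C0_section_ext => x /=; rewrite !scalerA mulrC. Qed.
Fact sec_actM f g s : sec_act (C0_mul f g) s = sec_act f (sec_act g s).
Proof. by apply: C0_section_ext => x /=; rewrite scalerA. Qed.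

Fact sec_act_norm f s : rnorm (sec_act f s) <= C0_norm f * rnorm s.
Proof.
have lef x : rnorm (f x) <= C0_norm f.
  have [M fM] := C0_bounded f; apply: ub_le_sup; last by exists x.
  by exists M => _ [y _ <-].
have f0 : 0 <= C0_norm f by apply: sup_range_ge0 => x; exact: rnorm_ge0.
rewrite !rnorm_sec; apply: sec_norm_le => [|x /=].
  by rewrite mulr_ge0 ?sec_norm_ge0.
by rewrite rnormZ ler_pM ?rnorm_ge0 ?le_sec_norm.
Qed.

Fact sec_nondegenerate :
  closure (lin_span [set sec_act f s | f in setT & s in setT]) = setT.
Proof.
apply/seteqP; split=> // s _ B /nbhs_ballP[e /= e0 eB].
have e0' : 0 < real_part e.
  by rewrite -(ltr_of_real (k := k)) real_partK ?ltW// of_real0.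
have e2 : 0 < real_part e / 2 by rewrite divr_gt0.
have [L cL sL] := sec_vanishing s e2; have [f f1] := C0_urysohn cL.
exists (sec_act f s); split.
  exists 1%N, (fun=> 1), (fun=> sec_act f s); split.
    by move=> _; exists f => //; exists s.
  by rewrite big_ord1 scale1r.
apply: eB; rewrite -(real_partK (ltW e0)); apply/ballP.
rewrite rnorm_sec (@le_lt_trans _ _ (real_part e / 2))//; last first.
  by rewrite ltr_pdivrMr// ltr_pMr// ltr1n.
apply: sec_norm_le (ltW e2) _ => x /=.
rewrite scaleN1r -{1}(scale1r (s x)) -scalerBl rnormZ.
have [fx1 fLx] := f1 x; have [/fLx ->|/sL sx] := pselect (L x).
  by rewrite subrr rnorm0 mul0r ltW.
by rewrite (le_trans _ sx)// ler_piMl ?rnorm_ge0.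
Qed.

Definition Gamma0_module : banach_module R k X := @BanachModule R k X
  S sec_act sec_actDl sec_actDr sec_actZl sec_actZr sec_actM sec_act_norm
  sec_nondegenerate.

Definition sec_pointwise_norm (s : S) (x : X) : R := rnorm (s x).

Fact sec_pointwise_norm_U0 s : U0_pos (sec_pointwise_norm s).
Proof.
split; last by move=> x; exact: rnorm_ge0.
split; first exact: sec_usc.
move=> e /(sec_vanishing s)[L cL sL]; exists L => // x /sL.
by rewrite ger0_norm ?rnorm_ge0.
Qed.

Fact sec_pointwise_norm_sup s : sup_norm (sec_pointwise_norm s) = rnorm s.
Proof.
rewrite rnorm_sec /sup_norm /sec_norm; congr (sup (_ @` _)).
by apply/funext => x; rewrite ger0_norm ?rnorm_ge0.
Qed.

Fact sec_pointwise_norm_act f s x :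
  sec_pointwise_norm (sec_act f s) x = rnorm (f x) * sec_pointwise_norm s x.
Proof. exact: rnormZ. Qed.

Fact sec_pointwise_normD s t x : sec_pointwise_norm (s + t) x <=
  sec_pointwise_norm s x + sec_pointwise_norm t x.
Proof. exact: rnormD. Qed.

Definition Gamma0 : U0_normed_module R k X := @U0NormedModule R k X
  Gamma0_module sec_pointwise_norm sec_pointwise_norm_U0
  sec_pointwise_norm_sup sec_pointwise_norm_act sec_pointwise_normD.

End Gamma0.

Section morphisms.
Context {R : realType} {k : scalar_kind}.

Definition total_map (X : topologicalType) (phi : X -> X)
    (E F : bundle_data (R := R) (k := k) X)
    (Phi : forall x, E x -> F (phi x)) (v : total_space E) : total_space F :=
  in_fiber (Phi (bundle_proj v) (projT2 v)).

(* Since Phi covers phi, it is given by its restrictions Phi|E_x. *)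
Record bundle_morphism (X : topologicalType) (phi : homeomorphism X X)
    (E F : banach_bundle (R := R) (k := k) X) := BundleMorphism {
  mor_fun :> forall x, E x -> F (phi x);
  mor_operator : forall x, bounded_operator (@mor_fun x);
  mor_continuous : continuous (total_map (@mor_fun));
  mor_bounded : has_ubound [set opnorm (@mor_fun x) | x in [set: X]] }.

Arguments mor_fun {X phi E F} _ _ _.

Definition mor_norm (X : topologicalType) (phi : homeomorphism X X)
    (E F : banach_bundle X) (Phi : bundle_morphism phi E F) : R :=
  sup [set opnorm (Phi x) | x in [set: X]].

Definition mor_isometric (X : topologicalType) (phi : homeomorphism X X)
    (E F : banach_bundle X) (Phi : bundle_morphism phi E F) : Prop :=
  forall x, isometric (Phi x).

(* T = T_Phi, i.e. T s = Phi \o s \o phi^-1 for all s, the sections being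
   viewed as maps into the total spaces. *)
Definition induced_by (X : lchType) (phi : homeomorphism X X)
    (E F : banach_bundle X) (T : Gamma0 E -> Gamma0 F)
    (Phi : bundle_morphism phi E F) : Prop :=
  forall s : Gamma0 E, section_map (T s : C0_section F) =
    total_map Phi \o section_map (s : C0_section E) \o homeo_inv phi.

End morphisms.

Arguments mor_fun {R k X phi E F} _ _ _.
Arguments mor_continuous {R k X phi E F} _.

(* Main.v *)
Require Import Defs.
From HB Require Import structures.
From mathcomp Require Import all_boot all_order all_algebra.
From mathcomp Require Import all_classical all_reals topology normedtype.
From mathcomp Require Import interval_inference lra.

(** Cutoff functions carry the equivalence of (a)-(d).  Let |s| be the
    pointwise norm of s.  Upper semicontinuity gives, for every point x and
    every e > 0, a cutoff f equal to 1 near x with ||f s|| <= |s|(x) + e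
    ([localization]).

    - (a) => (b): if T(f s) is nonzero, then so is f s.
    - (b) => (c): for the cutoff f above, s - f s vanishes near x, so
      T s and T(f s) have the same norm at phi(x), and this norm is at most
      ||T(f s)|| <= ||T|| (|s|(x) + e).
    - (c) => (d) is a matter of making the constant positive.
    - (d) => (a): |f s - f(x) s| is zero at x, so T(f s) - f(x) T s has norm zero
      at phi(x), and so has f(x) T s - (T_phi f)(T s).

    For bundles, Phi has to satisfy Phi_x(v) = (T s)(phi x) whenever s(x) = v,
    and (d) shows that the right-hand side depends on v only.  What makes this a
    definition on all of E_x, and what makes Phi unique, is that every vector
    of E lies on a section in Gamma_0(E) ([enough_sections], due to Douady and
    dal Soglio-Herault).

    The proof of that theorem measures how far a section is from being
    continuous ([eps_continuous]).  The section with the single nonzero value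
    v at x is ||v||-continuous and compactly supported.  Such an approximately
    continuous section can be replaced by one that is twice as good, has the
    same value at x and is uniformly close to it ([refinement]): near each
    point it suffices to choose arbitrary values in a small open subset of the
    total space, and cutoffs patch these choices together over the compact
    support.  The successive refinements converge uniformly, and their limit
    is continuous.

    The equality of norms and the statement on isometries follow again from
    localization, since Phi_x(s(x)) = (T s)(phi x). *)

Set Implicit Arguments.
Unset Strict Implicit.
Unset Printing Implicit Defensive.

Import Order.TTheory GRing.Theory Num.Theory.
Import numFieldNormedType.Exports.

Local Open Scope classical_set_scope.
Local Open Scope ring_scope.

(** * Cutoff functions *)

Section cutoff.
Context {R : realType} {X : lchType}.

(** The one-point compactification is normal, which separates x from the
    complement of U by a continuous function g.  Truncating 2 - 3 g makes the
    cutoff constant near x and gives it a compact support inside U. *)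
Lemma pointwise_cutoff (x : X) (U : set X) : open U -> U x ->
  exists2 h : X -> R, continuous h & exists2 L : set X, compact L &
  [/\ L `<=` U, forall y, 0 <= h y <= 1, (forall y, ~ L y -> h y = 0) &
      \forall y \near x, h y = 1].
Proof.
move=> oU Ux; pose opc := one_point_compactification X.
have hopc : hausdorff_space opc.
  apply: one_point_compactification_hausdorff.
    exact: lch_locally_compact.
  exact: lch_hausdorff.
have nopc : normal_space opc.
  exact: compact_normal hopc one_point_compactification_compact.
have clx : closed [set Some x : opc].
  exact/accessible_closed_set1/hausdorff_accessible.
have clU : closed (~` (Some @` U) : set opc).
  apply: open_closedC.
  exact: one_point_compactification_open_some.
have xU : [set Some x : opc] `&` ~` (Some @` U) = set0.
  by rewrite -subset0 => _ [-> /=]; apply; exists x.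
have /(@uniform_separatorP _ R)[g [cg g01 gx gU]] :=
  (@normal_separatorP R _).1 nopc _ _ clx clU xU.
have cgS : continuous (fun y : X => g (Some y)).
  move=> y; apply: (@continuous_comp X opc R Some g); last exact: cg.
  exact: one_point_compactification_some_continuous.
have gx0 : g (Some x) = 0 by apply: gx; exists (Some x).
have gN : g None = 1 by apply: gU; exists None => // -[].
have third_gt0 : (0 : R) < 3^-1 by rewrite invr_gt0.
pose h (y : X) : R := Num.min 1 (Num.max 0 (2 - 3 * g (Some y))).
have ch : continuous h.
  move=> y; apply: (@continuous_min R X (cst 1)
    (fun y => Num.max 0 (2 - 3 * g (Some y)))); first exact: cvg_cst.
  apply: (@continuous_max R X (cst 0) (fun y => 2 - 3 * g (Some y))).
    exact: cvg_cst.
  apply: cvgB; first exact: cvg_cst.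
  by apply: cvgM; [exact: cvg_cst|exact: cgS].
exists h => //; exists [set y | g (Some y) <= 2 / 3].
  have /cvgrPdist_lt/(_ _ third_gt0) := cg None.
  rewrite gN; case=> C [cC _] CE.
  apply: (@subclosed_compact _ _ C) => //.
    apply: (closed_comp (f := fun y : X => g (Some y))
      (D := [set r | r <= 2 / 3])).
      by move=> ? _; exact: cgS.
    exact: closed_le.
  move=> y /= gy; apply: contrapT => nCy.
  have /= : `|1 - g (Some y)| < 3^-1 by apply: (CE (Some y)); left; exists y.
  by rewrite ltNge => /negP; apply; rewrite ger0_norm; lra.
split.
- move=> y /= gy; apply: contrapT => nUy.
  have : g (Some y) = 1.
    apply: gU; exists (Some y) => // -[z Uz [zy]].
    by apply: nUy; rewrite -zy.
  by move=> gy1; move: gy; rewrite gy1; lra.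
- move=> y; rewrite /h le_min ler01 le_max lexx /= ge_min lexx //.
- move=> y /= /negP; rewrite -ltNge => gy; rewrite /h max_l; last lra.
  by rewrite min_r.
- have /cvgrPdist_lt/(_ _ third_gt0) := cgS x; rewrite gx0.
  apply: filterS => y; rewrite sub0r normrN => /ltr_normlP[_ gy].
  by rewrite /h min_l// le_max; apply/orP; right; lra.
Qed.
End cutoff.

(** * Approximate continuity of sections of a Banach bundle *)

Section fiberwise.
Context {R : realType} {k : scalar_kind} {X : topologicalType}
  (E : banach_bundle (R := R) (k := k) X).
Local Notation K := (scalars R k).

(** Openness of the projection: a neighborhood of a vector meets all nearby
    fibers. *)
Lemma near_lift (x : X) (v : E x) (V : set (total_space E)) :
  nbhs (in_fiber v) V -> \forall y \near x, exists b : E y, V (in_fiber b).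
Proof.
rewrite nbhsE => -[A [oA Av] AV].
have : nbhs x (@bundle_proj _ _ _ E @` A).
  by apply: open_nbhs_nbhs; split; [exact: bb_proj_open|exists (in_fiber v)].
by apply: filterS => y [[z b] /= Ab zy]; subst z; exists b; apply: AV.
Qed.

Lemma near_proj (x : X) (v : E x) (P : X -> Prop) : (\forall y \near x, P y) ->
  nbhs (in_fiber v) [set w : total_space E | P (bundle_proj w)].
Proof. exact: (bb_proj_continuous E (in_fiber v)). Qed.

Lemma near_norm_lt (x : X) (v : E x) (r : R) : rnorm v < r ->
  nbhs (in_fiber v) [set w : total_space E | bundle_norm w < r].
Proof.
by move=> vr; apply: open_nbhs_nbhs; split => //; exact: bb_norm_usc.
Qed.

(** Joint continuity of the bundle operations, in a form that speaks only of
    vectors over a common point; it covers sums, differences and blends. *)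
Lemma near_combination (a1 a2 : X -> K) (x : X) (v1 v2 : E x)
    (W : set (total_space E)) :
  {for x, continuous a1} -> {for x, continuous a2} ->
  nbhs (in_fiber (a1 x *: v1 + a2 x *: v2)) W ->
  exists V1 : set (total_space E), exists V2 : set (total_space E),
    [/\ nbhs (in_fiber v1) V1, nbhs (in_fiber v2) V2 &
    \forall y \near x, forall b1 b2 : E y,
      V1 (in_fiber b1) -> V2 (in_fiber b2) ->
      W (in_fiber (a1 y *: b1 + a2 y *: b2))].
Proof.
move=> ca1 ca2.
pose w0 : initial_topology (@fiber_square_incl _ _ X E) :=
  existT _ x (a1 x *: v1, a2 x *: v2).
move/(bb_add_continuous E w0); rewrite /= nbhs_filterE nbhsE.
move=> -[_ [[B oB <-] Bw0] BW].
have [[Z1 Z2] /= [vZ1 vZ2] ZB] :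
    nbhs (in_fiber (a1 x *: v1), in_fiber (a2 x *: v2)) B.
  exact: open_nbhs_nbhs (conj oB Bw0).
have scale_near (a : X -> K) (v : E x) (Z : set (total_space E)) :
    {for x, continuous a} -> nbhs (in_fiber (a x *: v)) Z ->
    exists2 V : set (total_space E), nbhs (in_fiber v) V &
    \forall y \near x, forall b : E y,
      V (in_fiber b) -> Z (in_fiber (a y *: b)).
  move=> ca vZ.
  have [[N V] /= [aN vV] NVZ] :=
    bb_scale_continuous E ((a x, in_fiber v) : K * total_space E) Z vZ.
  have xN : \forall y \near x, N (a y) := ca N aN.
  exists V => //; apply: filterS xN => y Nay b Vb.
  exact: (NVZ (a y, in_fiber b)).
have [V1 vV1 V1Z] := scale_near a1 v1 Z1 ca1 vZ1.
have [V2 vV2 V2Z] := scale_near a2 v2 Z2 ca2 vZ2.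
exists V1, V2; split => //; apply: filterS2 V1Z V2Z => y V1Z V2Z b1 b2 Vb1 Vb2.
apply: (BW (existT _ y (a1 y *: b1, a2 y *: b2))); apply: ZB; split => /=.
  exact: V1Z.
exact: V2Z.
Qed.

(** The difference of two vectors of the same fiber is jointly continuous and
    vanishes at (v, v), and the norm is upper semicontinuous. *)
Lemma thin_nbhs (x : X) (v : E x) (d : R) : 0 < d ->
  exists V : set (total_space E), [/\ open V, V (in_fiber v) &
    forall (y : X) (a b : E y), V (in_fiber a) -> V (in_fiber b) ->
      rnorm (a - b) < d].
Proof.
move=> d0.
have : nbhs (in_fiber (1 *: v + (-1) *: v))
    [set w : total_space E | bundle_norm w < d].
  by apply: near_norm_lt; rewrite scale1r scaleN1r subrr rnorm0.
case/(@near_combination (cst 1) (cst (-1)) x v v) => [||V1 [V2 [vV1 vV2 VW]]].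
- exact: cvg_cst.
- exact: cvg_cst.
have : \forall w \near in_fiber v,
    [/\ V1 w, V2 w & forall b1 b2 : E (bundle_proj w),
    V1 (in_fiber b1) -> V2 (in_fiber b2) ->
    bundle_norm (in_fiber (cst 1 (bundle_proj w) *: b1 +
                           cst (-1) (bundle_proj w) *: b2)) < d].
  by apply: filterS3 vV1 vV2 (near_proj v VW) => w.
rewrite /prop_near1 nbhsE => -[V [oV Vv] VV]; exists V; split => // y a b.
move=> /VV[V1a _ Vy] /VV[_ V2b _].
by have := Vy a b V1a V2b; rewrite /bundle_norm /= scale1r scaleN1r.
Qed.

(** Up to an error e in the fibers, the values of f near x lie in any given
    neighborhood of f x.  Comparing with vectors b of the neighborhood, and not
    with sections, makes the notion meaningful before any continuous section is
    known; the extra d > 0 makes it stable under limits. *)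
Definition eps_continuous (e : R) (f : forall x, E x) (x : X) : Prop :=
  forall (W : set (total_space E)) (d : R), nbhs (in_fiber (f x)) W -> 0 < d ->
    \forall y \near x,
      exists2 b : E y, W (in_fiber b) & rnorm (f y - b) < e + d.

Lemma eps_continuous_near (e : R) (f g : forall x, E x) (x : X) :
  (\forall y \near x, f y = g y) ->
  eps_continuous e f x -> eps_continuous e g x.
Proof.
move=> fg fe W d; rewrite -(nbhs_singleton fg) => gW d0.
by apply: filterS2 fg (fe W d gW d0) => y ->.
Qed.

Lemma eps_continuous0 (f : forall x, E x) (x : X) :
  (forall e : R, 0 < e -> eps_continuous e f x) ->
  {for x, continuous (section_map f)}.
Proof.
move=> fe W /add_near[V fV [e e0 eW]]; have e2 : 0 < e / 2 by rewrite divr_gt0.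
apply: filterS2 eW (fe _ e2 V _ fV e2) => y yW [b Vb fb].
have := yW b (f y - b) Vb; rewrite subrKC; apply.
by rewrite (splitr e) ltW.
Qed.

(** Passing from f to g costs 2 d because it changes both the vector f x, whose
    neighborhoods are tested, and the nearby values f y. *)
Lemma eps_continuous_perturb (e d : R) (f g : forall x, E x) (x : X) :
  (forall y, rnorm (g y - f y) <= d) -> eps_continuous e f x ->
  eps_continuous (e + 2 * d) g x.
Proof.
move=> gf fe W c gW c0; have c2 : 0 < c / 2 by rewrite divr_gt0.
have : nbhs (in_fiber (1 *: f x + 1 *: (g x - f x))) W.
  by rewrite !scale1r subrKC.
case/(@near_combination (cst 1) (cst 1) x) => [||V1 [V2 [fV1 gfV2 VW]]].
- exact: cvg_cst.
- exact: cvg_cst.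
have gfd : rnorm (g x - f x) < d + c / 2.
  by rewrite (le_lt_trans (gf x))// ltrDl.
have : \forall y \near x, exists b : E y,
    V2 (in_fiber b) /\ rnorm b < d + c / 2.
  by apply: (@near_lift x _ (V2 `&` [set w | bundle_norm w < _]));
    apply: filterI gfV2 (near_norm_lt gfd).
apply: filterS3 VW (fe _ _ fV1 c2) => y VW [b1 V1b fb] [b2 [V2b b2d]].
exists (b1 + b2).
  by have := VW _ _ V1b V2b; rewrite !scale1r.
rewrite (_ : g y - (b1 + b2) = (g y - f y) + (f y - b1) - b2); last first.
  by rewrite opprD !addrA subrK.
have := rnormD (g y - f y + (f y - b1)) (- b2); rewrite rnormN.
have := rnormD (g y - f y) (f y - b1); have := gf y.
by move: b2d; rewrite /bundle_norm /=; lra.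
Qed.

Lemma rnorm_blend (V : normedModType K) (c : R) (a b : V) (d : R) :
  0 <= c <= 1 -> rnorm a <= d -> rnorm b <= d ->
  rnorm (of_real k (1 - c) *: a + of_real k c *: b) <= d.
Proof.
move=> /andP[c0 c1] ad bd; apply: le_trans (rnormD _ _) _.
rewrite !rnormZ !rnorm_of_real !ger0_norm ?subr_ge0//.
rewrite (_ : d = (1 - c) * d + c * d); last by rewrite -mulrDl subrK mul1r.
by rewrite lerD ?ler_wpM2l ?subr_ge0.
Qed.

(** Convexity keeps the error equal to e however many blends are made, so
    the number of local pieces patched together does not matter. *)
Lemma eps_continuous_blend (e : R) (h : X -> R) (f g : forall x, E x) (x : X) :
  continuous h -> (forall y, 0 <= h y <= 1) ->
  eps_continuous e f x -> eps_continuous e g x ->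
  eps_continuous e
    (fun y => of_real k (1 - h y) *: f y + of_real k (h y) *: g y) x.
Proof.
move=> ch h01 fe ge W d fgW d0; have d2 : 0 < d / 2 by rewrite divr_gt0.
have := fgW.
case/(@near_combination (fun y => of_real k (1 - h y))
  (fun y => of_real k (h y)) x).
- apply: (@continuous_comp _ _ _ (fun y => 1 - h y) (of_real k)).
    by apply: cvgB; [exact: cvg_cst|exact: ch].
  exact: of_real_continuous.
- apply: (@continuous_comp _ _ _ h (of_real k)); first exact: ch.
  exact: of_real_continuous.
move=> V1 [V2 [fV1 gV2 VW]].
apply: filterS3 VW (fe _ _ fV1 d2) (ge _ _ gV2 d2).
move=> y VW [b1 V1b fb] [b2 V2b gb].
exists (of_real k (1 - h y) *: b1 + of_real k (h y) *: b2); first exact: VW.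
rewrite opprD addrACA -!scalerBr.
apply: (@le_lt_trans _ _ (e + d / 2)); last by lra.
by apply: rnorm_blend => //; exact: ltW.
Qed.

End fiberwise.

(** * Sections through a given vector *)

Section enough_sections.
Context {R : realType} {k : scalar_kind} {X : lchType}
  (E : banach_bundle (R := R) (k := k) X).
Local Notation K := (scalars R k).

(** Any choice of values in a thin open set V is d-continuous at every point
    of its domain, since the vectors of V over one point are within d of each
    other.  The choice can respect a prescribed value at x: if y <> x, the
    point x is avoided altogether, and if y = x, then f x itself belongs
    to V. *)
Lemma local_selection (e d : R) (f : forall y, E y) (x y : X) :
  0 < e -> 0 < d -> eps_continuous e f y ->
  exists2 U : set X, open U /\ U y & exists g : forall z, E z,
    forall z, U z -> [/\ rnorm (g z - f z) <= 2 * e, z = x -> g z = f z &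
                         eps_continuous d g z].
Proof.
move=> e0 d0 fe; have [V [oV Vf Vd]] := thin_nbhs (f y) d0.
pose good z (b : E z) :=
  [/\ V (in_fiber b), rnorm (b - f z) <= 2 * e & z = x -> b = f z].
have good_near : \forall z \near y, exists b : E z, good z b.
  have fV : nbhs (in_fiber (f y)) V by exact: open_nbhs_nbhs.
  have lift : \forall z \near y,
      exists2 b : E z, V (in_fiber b) & rnorm (b - f z) <= 2 * e.
    apply: filterS (fe V e fV e0) => z [b Vb fb]; exists b => //.
    by rewrite -rnormN opprB; lra.
  have [yx|yx] := eqVneq y x.
    apply: filterS lift => z [b Vb bf].
    have [zx|zx] := eqVneq z x; last first.
      by exists b; split => // /eqP zx'; rewrite zx' in zx.
    exists (f z); split => //; first by rewrite zx -yx.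
    by rewrite subrr rnorm0 mulr_ge0// ltW.
  have xC : \forall z \near y, z != x.
    have /hausdorff_accessible/accessible_closed_set1 := @lch_hausdorff X.
    move=> /(_ x)/closed_openC oxC; apply: (@filterS _ _ _ (~` [set x])).
      by move=> z /= /eqP.
    by apply: open_nbhs_nbhs; split => //=; exact/eqP.
  apply: filterS2 lift xC => z [b Vb bf] zx.
  by exists b; split => // /eqP zx'; rewrite zx' in zx.
have [U [oU Uy] Ugood] :
    exists2 U, open_nbhs y U & forall z, U z -> exists b : E z, good z b.
  by move: good_near; rewrite /prop_near1 /= nbhsE.
pose g z : E z := if pselect (exists b : E z, good z b) is left h
  then projT1 (cid h) else 0.
have gP z : U z -> good z (g z).
  move=> /Ugood Uz; rewrite /g; case: pselect => // h.
  exact: projT2 (cid h).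
exists U => //; exists g => z Uz; have [Vg gf gx] := gP z Uz; split => //.
move=> W c gW c0.
have gV : nbhs (in_fiber (g z)) V by exact: open_nbhs_nbhs.
have /near_lift lift : nbhs (in_fiber (g z)) (V `&` W) by exact: filterI.
have zU : \forall t \near z, U t by exact: open_nbhs_nbhs.
apply: filterS2 zU lift => t Ut [b [Vb Wb]]; exists b => //.
have [Vgt _ _] := gP t Ut.
by apply: lt_trans (Vd _ _ _ Vgt Vb) _; rewrite ltrDl.
Qed.

Definition compactly_supported (f : forall y, E y) : Prop :=
  exists2 L : set X, compact L & forall y, ~ L y -> f y = 0.

(** The set A on which d-continuity has been achieved is a parameter, so that
    it can be enlarged step by step to the whole space. *)
Definition refines_on (e d : R) (f : forall y, E y) (x : X) (A : set X)
    (g : forall y, E y) : Prop :=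
  [/\ g x = f x, compactly_supported g, forall y, rnorm (g y - f y) <= 2 * e &
      forall y, A y -> eps_continuous d g y].

(** The neighborhood U does not depend on g, as needed to cover a compact set
    by finitely many such U.  The new section blends g with a local selection
    s by a cutoff h supported in the domain of s and equal to 1 on U.  It
    equals s on U, and elsewhere it keeps the continuity that g already has. *)
Lemma refinement_near (e d : R) (f : forall y, E y) (x y : X) :
  0 < e -> 0 < d -> eps_continuous e f y ->
  exists2 U : set X, open U /\ U y & forall (A : set X) g,
    refines_on e d f x A g -> exists g', refines_on e d f x (A `|` U) g'.
Proof.
move=> e0 d0 fe; have [U [oU Uy] [s sP]] := local_selection x e0 d0 fe.
have [h ch [L cL [LU h01 hL hy]]] := pointwise_cutoff (R := R) oU Uy.
have [V [oV Vy] Vh] : exists2 V, open_nbhs y V & forall z, V z -> h z = 1.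
  by move: hy; rewrite /prop_near1 /= nbhsE.
exists V => // A g [gx [M cM gM] gf gA].
pose g' z := of_real k (1 - h z) *: g z + of_real k (h z) *: s z.
have g'0 z : ~ L z -> g' z = g z.
  by move=> /hL hz; rewrite /g' hz subr0 of_real1 of_real0 scale1r scale0r addr0.
have VU : V `<=` U.
  move=> z /Vh hz; apply: LU; apply: contrapT => /hL.
  by rewrite hz => /eqP; rewrite oner_eq0.
have blend0 z (v : E z) : v = of_real k (1 - h z) *: v + of_real k (h z) *: v.
  by rewrite -scalerDl -of_realD subrK of_real1 scale1r.
exists g'; split.
- have [Lx|/g'0 ->//] := pselect (L x).
  have [_ sx _] := sP x (LU _ Lx).
  by rewrite /g' gx (sx erefl) -blend0.
- exists (L `|` M); first exact: compactU.
  by move=> z /not_orP[/g'0 -> /gM].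
- move=> z; have [Lz|/g'0 ->//] := pselect (L z).
  rewrite [f z]blend0 /g' opprD addrACA -!scalerBr.
  have [sf _ _] := sP z (LU _ Lz).
  exact: rnorm_blend (h01 z) (gf z) sf.
- move=> z AVz; have [Uz|nUz] := pselect (U z); last first.
    have nLz : ~ L z by move=> /LU.
    have gz : \forall t \near z, g t = g' t.
      apply: (@filterS _ _ _ (~` L)); first by move=> t /g'0.
      apply: open_nbhs_nbhs; split => //; apply: closed_openC.
      exact: compact_closed (@lch_hausdorff X) cL.
    by apply: eps_continuous_near gz _; case: AVz => [/gA//|/VU].
  have [_ _ sz] := sP z Uz.
  have [Vz|nVz] := pselect (V z); last first.
    by apply: eps_continuous_blend => //; case: AVz => // /gA.
  apply: eps_continuous_near sz; apply: (@filterS _ _ _ V).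
    move=> t /Vh ht.
    by rewrite /g' ht subrr of_real0 of_real1 scale0r scale1r add0r.
  exact: open_nbhs_nbhs.
Qed.

(** Off the compact support of f nothing has to be done, as f is locally zero
    there.  The sets that can be absorbed into the domain of d-continuity are
    stable under finite unions, and every point has one as a neighborhood, so
    the support is contained in one of them. *)
Lemma refinement (e d : R) (f : forall y, E y) (x : X) : 0 < e -> 0 < d ->
  compactly_supported f -> (forall y, eps_continuous e f y) ->
  exists g, refines_on e d f x setT g.
Proof.
move=> e0 d0 [L cL fL] fe.
have oLC : open (~` L).
  by apply: closed_openC; exact: compact_closed (@lch_hausdorff X) cL.
pose absorbable (B : set X) := forall A g, refines_on e d f x A g ->
  exists g', refines_on e d f x (A `|` B) g'.
(* The supersets of absorbable sets form a filter, which turns the finite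
   covering argument into an instance of the near-covering property. *)
have absorbF : Filter (filter_from absorbable (fun B => [set A | B `<=` A])).
  apply: filter_from_filter => [|B C aB aC].
    by exists set0 => A g Ag; exists g; rewrite setU0.
  exists (B `|` C); last first.
    by move=> A BCA; split=> y By; apply: BCA; [left|right].
  by move=> A g /aB[g1 /aC]; rewrite setUA.
have [B aB LB] : exists2 B, absorbable B & L `<=` B.
  have /compact_near_coveringP/(_ _ _ (fun A y => A y) absorbF)[|B aB] := cL.
    move=> y _; have [U [oU Uy] aU] := refinement_near x e0 d0 (fe y).
    exists (U, [set A | U `<=` A]) => /=; last by move=> [z A] /= [Uz]; apply.
    by split; [apply: open_nbhs_nbhs|exists U].
  by move=> /(_ B (@subset_refl _ B)); exists B.
have f0C : refines_on e d f x (~` L) f.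
  split => // [|y|y nLy]; first by exists L.
    by rewrite subrr rnorm0 mulr_ge0// ltW.
  have f0 : \forall z \near y, 0 = f z.
    by apply: (@filterS _ _ _ (~` L)) => [z /fL|]; last exact: open_nbhs_nbhs.
  apply: eps_continuous_near f0 _ => W c W0 c0.
  have yW : \forall z \near y, W (in_fiber (0 : E z)) :=
    zero_sec_continuous (E := E) W0.
  by apply: filterS yW => z Wz; exists 0; rewrite // subrr rnorm0 addr_gt0.
have [g [gx cg gf ge]] := aB _ _ f0C; exists g; split => // y _; apply: ge.
by have [/LB|] := pselect (L y); [right|left].
Qed.

(** Near x the zero vector is within e of suitable vectors close to v: those
    of norm less than e + d, which form a neighborhood of v and hence meet all
    nearby fibers. *)
Lemma spike_eps_continuous (x : X) (v : E x) (e : R) : rnorm v <= e ->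
  exists f : forall y, E y,
    [/\ f x = v, compactly_supported f & forall y, eps_continuous e f y].
Proof.
move=> ve; pose f y : E y :=
  if pselect (x = y) is left xy then ecast y (E y) xy v else 0.
have fx : f x = v.
  by rewrite /f; case: pselect => // xx; rewrite (Prop_irrelevance xx erefl).
have fy y : x <> y -> f y = 0 by rewrite /f; case: pselect.
exists f; split => //.
  exists [set x]; first exact: compact_set1.
  by move=> y /= nyx; apply: fy => xy; apply: nyx.
move=> y W d fW d0; have [yx|yx] := pselect (x = y); last first.
  have xy : \forall z \near y, x <> z.
    have /hausdorff_accessible/accessible_closed_set1 := @lch_hausdorff X.
    move=> /(_ x)/closed_openC oxC; apply: (@filterS _ _ _ (~` [set x])).
      by move=> z /= zx xz; apply: zx.
    by apply: open_nbhs_nbhs; split => //= xy; apply: yx.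
  rewrite fy// in fW; have yW := zero_sec_continuous (E := E) fW.
  apply: filterS2 xy yW => z xz Wz; exists 0 => //.
  rewrite fy// subrr rnorm0; have := rnorm_ge0 v; lra.
move: fW; rewrite -{y}yx fx => vW.
have ved : rnorm v < e + d by lra.
have : \forall z \near x, exists b : E z, W (in_fiber b) /\ rnorm b < e + d.
  by apply: (@near_lift _ _ _ _ x _ (W `&` [set w | bundle_norm w < _]));
    apply: filterI vW (near_norm_lt ved).
apply: filterS => z [b [Wb be]]; have [xz|xz] := pselect (x = z); last first.
  by exists b => //; rewrite fy// sub0r rnormN.
exists (f z); last by rewrite subrr rnorm0; have := rnorm_ge0 v; lra.
by case: z / xz b Wb be => *; rewrite fx; exact: nbhs_singleton vW.
Qed.

(** The errors c / 2^n are summable, so the refinements f n of a spike at x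
    form a uniform Cauchy sequence.  The limit l is within 4 c / 2^n of f n,
    and hence 9 c / 2^n-continuous for every n. *)
Lemma enough_sections (x : X) (v : E x) : exists s : C0_section E, s x = v.
Proof.
(* The 1 is there to make the errors positive when v is zero. *)
pose c := rnorm v + 1.
have c0 : 0 < c by have := rnorm_ge0 v; rewrite /c; lra.
pose eps n : R := c / 2 ^+ n.
have eps0 n : 0 < eps n by rewrite divr_gt0// exprn_gt0.
have epsS n : eps n.+1 = eps n / 2 by rewrite /eps exprSr invfM mulrA.
pose good n (f : forall y, E y) :=
  [/\ f x = v, compactly_supported f & forall y, eps_continuous (eps n) f y].
have next n (f : {f | good n f}) : {g | good n.+1 g &
    forall y, rnorm (g y - projT1 f y) <= 2 * eps n}.
  case: f => f [fx cf fe] /=; apply: cid2.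
  have [g [gx cg gf ge]] := refinement x (eps0 n) (eps0 n.+1) cf fe.
  exists g => //; split => //; first by rewrite gx.
  by move=> y; exact: ge.
have [f0 f0P] : {f | good 0%N f}.
  apply: cid; have vc : rnorm v <= eps 0%N by rewrite /eps expr0 divr1 /c; lra.
  by have [f fP] := spike_eps_continuous vc; exists f.
pose F := fix F n : {f | good n f} := if n is m.+1 then
  exist _ (s2val (next m (F m))) (s2valP (next m (F m))) else exist _ f0 f0P.
pose f n := projT1 (F n).
have fP n : good n (f n) := projT2 (F n).
have fS n y : rnorm (f n.+1 y - f n y) <= 2 * eps n := s2valP' (next n (F n)) y.
have fnm n m y : rnorm (f (n + m)%N y - f n y) <= 4 * (eps n - eps (n + m)%N).
  elim: m => [|m IH]; first by rewrite addn0 !subrr rnorm0 mulr0.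
  rewrite addnS -(subrKA (f (n + m)%N y)); apply: le_trans (rnormD _ _) _.
  by have := fS (n + m)%N y; have := epsS (n + m)%N; lra.
have fn n m y : (n <= m)%N -> rnorm (f m y - f n y) <= 4 * eps n.
  move=> nm; have := fnm n (m - n)%N y; rewrite subnKC// => /le_trans; apply.
  by have := eps0 m; lra.
have eps_lt (d : R) : 0 < d -> exists n, eps n < d.
  move=> d0; have dc : 0 < d / c by rewrite divr_gt0.
  have [n] := filter_ex (near_infty_natSinv_expn_lt (PosNum dc)).
  by rewrite /= ltr_pdivlMr// mulrC mulrA mulr1; exists n.
have fc y : cauchy (f ^~ y @ \oo).
  apply/cauchy_rnormP => d d0.
  have [n nd] : exists n, eps n < d / 8 by apply: eps_lt; rewrite divr_gt0.
  exists [set w | exists2 m, (n <= m)%N & w = f m y].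
    by exists n => // m /= nm; exists m.
  move=> _ _ [p np ->] [q nq ->]; rewrite -(subrKA (f n y)).
  apply: le_lt_trans (rnormD _ _) _; have := fn _ _ y np; have := fn _ _ y nq.
  by rewrite -rnormN opprB; lra.
pose l y : E y := lim (f ^~ y @ \oo).
have fl y : f ^~ y @ \oo --> l y by apply: cauchy_cvg; exact: fc.
have lf n y : rnorm (l y - f n y) <= 4 * eps n.
  apply/ler_addgt0Pr => d d0.
  have /cvg_rnormP/(_ _ d0)[m _ /(_ (maxn n m) (leq_maxr _ _)) /= lm] := fl y.
  rewrite -(subrKA (f (maxn n m) y)); apply: le_trans (rnormD _ _) _.
  by have := fn _ _ y (leq_maxl n m); lra.
have lx : l x = v.
  apply/eqP; rewrite -subr_eq0; apply/eqP/rnorm_eq0/le_anti.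
  rewrite rnorm_ge0 andbT; apply/ler_addgt0Pr => d d0; rewrite add0r.
  have [n nd] : exists n, eps n < d / 4 by apply: eps_lt; rewrite divr_gt0.
  by have := lf n x; have [-> _ _] := fP n; lra.
have lc : continuous (section_map l).
  move=> y; apply: eps_continuous0 => d d0.
  have [n nd] : exists n, eps n < d / 9 by apply: eps_lt; rewrite divr_gt0.
  have [_ _ /(_ y) fe] := fP n.
  have le := eps_continuous_perturb (lf n) fe.
  move=> W b lW b0; apply: filterS (le W b lW b0) => z [w Ww lw].
  by exists w => //; lra.
have lv : vanishing (fun y => rnorm (l y)).
  move=> d d0.
  have [n nd] : exists n, eps n < d / 4 by apply: eps_lt; rewrite divr_gt0.
  have [_ [L cL fL] _] := fP n; exists L => // y /fL fy.
  by have := lf n y; rewrite fy subr0; lra.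
by exists (MkC0Section lc lv).
Qed.

End enough_sections.

(** * Operators and their norms *)

Lemma rnorm1 (R : realType) (k : scalar_kind) : rnorm (1 : scalars R k) = 1.
Proof. by rewrite -of_real1 rnorm_of_real normr1. Qed.

Section operators.
Context {R : realType} {k : scalar_kind} {V W : normedModType (scalars R k)}.
Implicit Type f : V -> W.

Lemma operatorB f : linear f -> {morph f : u v / u - v}.
Proof. by move=> fL u v; rewrite addrC -scaleN1r fL scaleN1r addrC. Qed.

Lemma operator0 f : linear f -> f 0 = 0.
Proof. by move=> fL; rewrite -(subrr 0) operatorB// subrr. Qed.

Lemma operatorZ f : linear f -> forall a, {morph f : u / a *: u}.
Proof. by move=> fL a u; rewrite -[a *: u]addr0 fL operator0// addr0. Qed.

Lemma opnorm_le f (M : R) : linear f -> 0 <= M ->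
  (forall v, rnorm (f v) <= M * rnorm v) -> opnorm f <= M.
Proof.
move=> fL M0 fM; apply: ge_sup.
  by exists (rnorm (f 0)), 0 => //=; rewrite rnorm0.
move=> _ [v /= v1 <-]; apply: le_trans (fM v) _.
by rewrite -[leRHS]mulr1 ler_wpM2l.
Qed.

Lemma opnorm_has_ubound f : bounded_operator f ->
  has_ubound [set rnorm (f v) | v in [set v | rnorm v <= 1]].
Proof.
move=> [_ [M fM]].
exists (Num.max M 0) => _ [w /= w1 <-]; apply: le_trans (fM w) _.
apply: (@le_trans _ _ (Num.max M 0 * rnorm w)).
  by rewrite ler_wpM2r ?rnorm_ge0// le_max lexx.
by rewrite -[leRHS]mulr1 ler_wpM2l// le_max lexx orbT.
Qed.

Lemma opnorm_ge0 f : bounded_operator f -> 0 <= opnorm f.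
Proof.
move=> bf; apply: ub_le_sup; first exact: opnorm_has_ubound.
by exists 0 => /=; rewrite ?operator0 ?rnorm0//; case: bf.
Qed.

Lemma rnorm_operator f v :
  bounded_operator f -> rnorm (f v) <= opnorm f * rnorm v.
Proof.
move=> bf; have [fL _] := bf; have [->|v0] := eqVneq v 0.
  by rewrite operator0// !rnorm0 mulr0.
have v_gt0 : 0 < rnorm v.
  rewrite lt_neqAle rnorm_ge0 andbT eq_sym.
  by apply: contra_neq v0; exact: rnorm_eq0.
have rnorm_inv : rnorm (of_real k (rnorm v)^-1) = (rnorm v)^-1.
  by rewrite rnorm_of_real ger0_norm ?invr_ge0 ?rnorm_ge0.
rewrite -ler_pdivrMr//; apply: ub_le_sup; first exact: opnorm_has_ubound.
exists (of_real k (rnorm v)^-1 *: v) => /=.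
  by rewrite rnormZ rnorm_inv mulVf// lt0r_neq0.
by rewrite operatorZ// rnormZ rnorm_inv mulrC.
Qed.

End operators.

(** * Modules with a pointwise norm *)

Section normed_modules.
Context {R : realType} {k : scalar_kind} {X : lchType}.
Local Notation K := (scalars R k).

Lemma C0_cutoff (x : X) (U : set X) : open U -> U x -> exists f : C0 R k X,
  [/\ forall y, rnorm (f y) <= 1, \forall y \near x, f y = 1 &
      forall y, ~ U y -> f y = 0].
Proof.
move=> oU Ux.
have [h ch [L cL [LU h01 hL hx]]] := pointwise_cutoff (R := R) oU Ux.
have cf : continuous (fun y => of_real k (h y)).
  move=> y; apply: (@continuous_comp _ _ _ h (of_real k)); first exact: ch.
  exact: of_real_continuous.
have vf : vanishing (fun y => rnorm (of_real k (h y))).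
  by move=> e e0; exists L => // y /hL ->; rewrite of_real0 rnorm0 ltW.
exists (MkC0 cf vf); split => [y||y nUy] /=.
- by rewrite rnorm_of_real; have /andP[? ?] := h01 y; rewrite ger0_norm.
- by apply: filterS hx => y ->; rewrite of_real1.
- by rewrite hL ?of_real0// => /LU.
Qed.

Context {M : U0_normed_module R k X}.
Implicit Types (s t : M) (f : C0 R k X).

Lemma um_norm_le s x : um_norm s x <= rnorm s.
Proof.
have [[us vs] s0] := um_norm_U0 s.
have [B sB] : exists B, forall y, um_norm s y <= B.
  apply: usc_vanishing_bounded => // e /vs[L cL sL]; exists L => // y /sL.
  by rewrite ger0_norm.
rewrite -um_norm_sup; apply: ub_le_sup; last first.
  by exists x => //; rewrite ger0_norm.
by exists B => _ [y _ <-]; rewrite ger0_norm.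
Qed.

Lemma le_um_norm s (B : R) :
  0 <= B -> (forall x, um_norm s x <= B) -> rnorm s <= B.
Proof.
move=> B0 sB; have [_ s0] := um_norm_U0 s; rewrite -um_norm_sup /sup_norm.
have [->|ne] := pselect ([set `|um_norm s x| | x in [set: X]] = set0).
  by rewrite sup0.
apply: ge_sup; first exact/set0P/eqP.
by move=> _ [x _ <-]; rewrite ger0_norm.
Qed.

Lemma um_norm_ge0 s x : 0 <= um_norm s x.
Proof. by have [_] := um_norm_U0 s. Qed.

Lemma um_norm0 x : um_norm (0 : M) x = 0.
Proof.
by apply/le_anti; rewrite um_norm_ge0 -(rnorm0 M) um_norm_le.
Qed.

Lemma um_norm_eq0 s : (forall x, um_norm s x = 0) -> s = 0.
Proof.
move=> s0; apply/rnorm_eq0/le_anti; rewrite rnorm_ge0 andbT.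
by apply: le_um_norm => // x; rewrite s0.
Qed.

Lemma C0_one_at x : exists f : C0 R k X, f x = 1.
Proof.
have [f [_ fx _]] := @C0_cutoff x setT openT I.
by exists f; exact: nbhs_singleton fx.
Qed.

(** The constant a need not be in C_0, but at x it can be replaced by the
    function a h with h x = 1. *)
Lemma um_norm_scale (a : K) s x : um_norm (a *: s) x = rnorm a * um_norm s x.
Proof.
have [h hx] := C0_one_at x.
have h1 t : um_norm t x = um_norm (bm_act h t) x.
  by rewrite um_norm_act hx rnorm1 mul1r.
by rewrite h1 bm_actZr -bm_actZl um_norm_act /= hx mulr1.
Qed.

Lemma um_normN s x : um_norm (- s) x = um_norm s x.
Proof. by rewrite -scaleN1r um_norm_scale rnormN rnorm1 mul1r. Qed.

(** At x, the function f acts like its value f x: after multiplication by h with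
    h x = 1, the difference becomes the action of h f - f(x) h, which vanishes
    at x. *)
Lemma um_norm_actB f s x : um_norm (bm_act f s - f x *: s) x = 0.
Proof.
have [h hx] := C0_one_at x.
have : um_norm (bm_act h (bm_act f s - f x *: s)) x = 0.
  rewrite bm_actDr -scaleN1r bm_actZr bm_actZr -bm_actM -!bm_actZl -bm_actDl.
  by rewrite um_norm_act /= hx mul1r mulr1 mulN1r subrr rnorm0 mul0r.
by rewrite um_norm_act hx rnorm1 mul1r.
Qed.

Lemma um_norm_eq_at s t x : um_norm (s - t) x = 0 -> um_norm s x = um_norm t x.
Proof.
have le (u v : M) : um_norm (u - v) x = 0 -> um_norm u x <= um_norm v x.
  move=> uv; have := um_normD (u - v) v x; rewrite uv add0r.
  by rewrite subrK.
by move=> st; apply/le_anti; rewrite !le// -opprB um_normN.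
Qed.

Lemma rnorm_act_le f s (B : R) : 0 <= B -> (forall x, rnorm (f x) <= 1) ->
  (forall x, ~ um_norm s x <= B -> f x = 0) -> rnorm (bm_act f s) <= B.
Proof.
move=> B0 f1 fs; apply: le_um_norm => // x; rewrite um_norm_act.
have [sB|/fs ->] := pselect (um_norm s x <= B); last by rewrite rnorm0 mul0r.
by apply: le_trans sB; rewrite ler_piMl// um_norm_ge0.
Qed.

(** The cutoff is supported where |s| < |s|(x) + e, an open set by upper
    semicontinuity. *)
Lemma localization s x (e : R) : 0 < e -> exists f : C0 R k X,
  [/\ forall y, rnorm (f y) <= 1, \forall y \near x, f y = 1 &
      rnorm (bm_act f s) <= um_norm s x + e].
Proof.
move=> e0; have [[us _] _] := um_norm_U0 s.
have [|f [f1 fx fU]] := C0_cutoff (x := x) (us (um_norm s x + e)).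
  by rewrite /= ltrDl.
exists f; split => //; apply: rnorm_act_le => //.
  by rewrite addr_ge0 ?um_norm_ge0 ?ltW.
by move=> y sy; apply: fU => /ltW.
Qed.

(** A cutoff g at x supported where f = 1 satisfies g = g f, so it annihilates
    s - f s. *)
Lemma notin_supp f s x :
  (\forall y \near x, f y = 1) -> ~ supp (s - bm_act f s) x.
Proof.
rewrite /prop_near1 nbhsE => -[U [oU Ux] Uf].
have [g [_ gx gU]] := C0_cutoff oU Ux.
move=> /(_ g); rewrite (nbhs_singleton gx) oner_eq0 => /(_ isT)/eqP; apply.
rewrite bm_actDr -scaleN1r bm_actZr -bm_actM -bm_actZl -bm_actDl.
rewrite (_ : _ + _ = 0 *: g); first by rewrite bm_actZl scale0r.
apply: C0_ext => y /=; have [/Uf ->|/gU ->] := pselect (U y).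
  by rewrite mul0r mulr1 mulN1r subrr.
by rewrite !mul0r !mulr0 addr0.
Qed.

Lemma um_norm_notin_supp s x : ~ supp s x -> um_norm s x = 0.
Proof.
move=> /existsNP[f /not_implyP[fx /negP/negPn/eqP fs]].
have := um_norm_act f s x; rewrite fs um_norm0 => /esym/eqP.
rewrite mulf_eq0 => /orP[/eqP/rnorm_eq0 fx0|/eqP//].
by move: fx; rewrite fx0 eqxx.
Qed.

End normed_modules.

(** * Weighted operators between normed modules *)

Section conditions.
Context {R : realType} {k : scalar_kind} {X : lchType}.
Context (phi : homeomorphism X X) {Gamma Lambda : U0_normed_module R k X}.
Context (T : Gamma -> Lambda) (bT : bounded_operator T).

Definition weighted := forall f s,
  T (bm_act f s) = bm_act (C0_transport phi f) (T s).

Definition support_decreasing := forall s, supp (T s) `<=` phi @` supp s.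

Definition dominated (m : R) := forall s x,
  um_norm (T s) x <= m * (um_norm s \o homeo_inv phi) x.

Lemma weighted_support_decreasing : weighted -> support_decreasing.
Proof.
move=> Tw s x sx; exists (homeo_inv phi x); last exact: homeo_invK.
move=> f fx; have := sx (C0_transport phi f) fx; rewrite -Tw.
by apply: contra_neq => ->; rewrite operator0//; case: bT.
Qed.

(** A cutoff f at y = phi^-1 x makes s - f s vanish near y, so T s and T(f s)
    have the same norm at x, and ||f s|| is almost |s|(y). *)
Lemma support_decreasing_dominated : support_decreasing -> dominated (opnorm T).
Proof.
move=> Ts s x; have [TL _] := bT; set y := homeo_inv phi x.
have T0 := opnorm_ge0 bT.
apply/ler_addgt0Pr => e e0.
have d0 : 0 < e / (opnorm T + 1) by rewrite divr_gt0// ltr_wpDl.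
have [f [_ fy fs]] := localization s y d0.
have : um_norm (T s - T (bm_act f s)) x = 0.
  rewrite -operatorB//; apply: um_norm_notin_supp => /Ts[z sz zx].
  by have := notin_supp (s := s) fy; rewrite /y -zx homeo_funK.
move=> /um_norm_eq_at ->; apply: le_trans (um_norm_le _ _) _.
apply: le_trans (rnorm_operator _ bT) _.
apply: le_trans (ler_wpM2l T0 fs) _; rewrite mulrDr lerD2l.
by rewrite mulrCA ler_piMr ?(ltW e0)// ler_pdivrMr ?mul1r ?lerDl// ltr_wpDl.
Qed.

Lemma dominated_pos (c : R) : 0 <= c -> dominated c ->
  exists2 m : R, 0 < m & dominated m.
Proof.
move=> c0 Tc; exists (c + 1); first by rewrite ltr_wpDl.
move=> s x; apply: le_trans (Tc s x) _.
by rewrite ler_wpM2r ?um_norm_ge0// lerDl.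
Qed.

(** Both sides are compared at x with c T s, where c is the value at x of the
    transported function. *)
Lemma dominated_weighted (m : R) : dominated m -> weighted.
Proof.
move=> Tm f s; have [TL _] := bT; apply/eqP; rewrite -subr_eq0; apply/eqP.
apply: um_norm_eq0 => x; set c := C0_transport phi f x.
have Tfs : um_norm (T (bm_act f s) - c *: T s) x = 0.
  rewrite -operatorZ// -operatorB//; apply/le_anti; rewrite um_norm_ge0 andbT.
  by apply: le_trans (Tm _ _) _; rewrite /= um_norm_actB mulr0.
have /um_norm_eq_at : um_norm
    ((T (bm_act f s) - bm_act (C0_transport phi f) (T s)) -
     (c *: T s - bm_act (C0_transport phi f) (T s))) x = 0.
  by rewrite opprB addrA subrK.
by move=> ->; rewrite -opprB um_normN um_norm_actB.
Qed.

(** Localization bounds |s|(x) from below by a global norm ||f s|| up to e, and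
    an isometry preserves ||f s||. *)
Lemma weighted_isometric_le s x : weighted -> isometric T ->
  um_norm (T s) (phi x) <= um_norm s x.
Proof.
move=> Tw Ti; apply/ler_addgt0Pr => e e0.
have [f [_ /nbhs_singleton fx fs]] := localization s x e0.
have -> : um_norm (T s) (phi x) = um_norm (T (bm_act f s)) (phi x).
  by rewrite Tw um_norm_act /= homeo_funK fx rnorm1 mul1r.
by apply: le_trans (um_norm_le _ _) _; rewrite Ti.
Qed.

(** Here T s is localized at phi x, by the transport of a cutoff f at x. *)
Lemma weighted_isometric_ge s x : weighted -> isometric T ->
  um_norm s x <= um_norm (T s) (phi x).
Proof.
move=> Tw Ti; apply/ler_addgt0Pr => e e0.
have [[uT _] _] := um_norm_U0 (T s).
have oU :
    open (phi @^-1` [set y | um_norm (T s) y < um_norm (T s) (phi x) + e]).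
  by apply: open_comp => [y _|]; [exact: homeo_fun_continuous|exact: uT].
have xU : um_norm (T s) (phi x) < um_norm (T s) (phi x) + e by rewrite ltrDl.
have [f [f1 /nbhs_singleton fx fU]] := @C0_cutoff R k X x _ oU xU.
have -> : um_norm s x = um_norm (bm_act f s) x.
  by rewrite um_norm_act /= fx rnorm1 mul1r.
apply: le_trans (um_norm_le _ _) _; rewrite -Ti Tw.
apply: rnorm_act_le => [|y|y sy]; first by rewrite addr_ge0 ?um_norm_ge0 ?ltW.
- exact: f1.
- by apply: fU; rewrite /= homeo_invK => /ltW.
Qed.

End conditions.

(** * Bundle morphisms *)

Section bundle_case.
Context {R : realType} {k : scalar_kind} {X : lchType}.
Context (phi : homeomorphism X X) {E F : banach_bundle (R := R) (k := k) X}.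

Lemma in_fiber_inj (B : bundle_data (R := R) (k := k) X) (x : X) (v w : B x) :
  in_fiber v = in_fiber w -> v = w.
Proof. exact: eq_from_Tagged. Qed.

Lemma induced_byP (T : Gamma0 E -> Gamma0 F) (Phi : bundle_morphism phi E F) :
  induced_by T Phi <->
  forall (s : C0_section E) x, (T s : C0_section F) (phi x) = Phi x (s x).
Proof.
split=> [TPhi s x|TPhi s].
  apply: in_fiber_inj; have := congr1 (fun f => f (phi x)) (TPhi s).
  by rewrite /section_map /= => ->; rewrite homeo_funK.
apply/funext => y; rewrite -(homeo_invK phi y) /= homeo_funK.
by rewrite /section_map TPhi.
Qed.

Lemma bundle_morphism_ext (Phi Psi : bundle_morphism phi E F) :
  (forall x v, Phi x v = Psi x v) -> Phi = Psi.
Proof.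
case: Phi Psi => [p po pc pb] [q qo qc qb] /= pq.
have {}pq : p = q.
  by apply: functional_extensionality_dep => x; apply/funext => v; exact: pq.
by subst q; congr BundleMorphism; exact: Prop_irrelevance.
Qed.

Lemma near_section (s : C0_section E) (x : X) (e : R) : 0 < e ->
  nbhs (in_fiber (s x))
    [set w : total_space E | rnorm (projT2 w - s (projT1 w)) < e].
Proof.
move=> e0.
have : nbhs (in_fiber (1 *: s x + (-1) *: s x))
    [set w : total_space E | bundle_norm w < e].
  by apply: near_norm_lt; rewrite scale1r scaleN1r subrr rnorm0.
case/(@near_combination _ _ _ _ (cst 1) (cst (-1)) x) =>
  [||V1 [V2 [sV1 sV2 VW]]].
- exact: cvg_cst.
- exact: cvg_cst.
have xV2 : \forall y \near x, V2 (in_fiber (s y)) := sec_continuous s x _ sV2.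
apply: filterS3 sV1 (near_proj (s x) VW) (near_proj (s x) xV2).
move=> [y v] /= V1v Vy V2s.
by have := Vy v (s y) V1v V2s; rewrite /bundle_norm /= scale1r scaleN1r.
Qed.

Section morphism_of_dominated.
Context (T : Gamma0 E -> Gamma0 F) (m : R).
Context (TL : linear T) (m0 : 0 < m) (Tm : dominated phi T m).

Lemma dominated_at (s : C0_section E) x :
  rnorm ((T s : C0_section F) (phi x)) <= m * rnorm (s x).
Proof. by have := Tm s (phi x); rewrite /= homeo_funK. Qed.

Definition section_through (x : X) (v : E x) : C0_section E :=
  projT1 (cid (enough_sections v)).

Lemma section_throughE (x : X) (v : E x) : section_through v x = v.
Proof. exact: projT2 (cid (enough_sections v)). Qed.

Definition fiber_map (x : X) (v : E x) : F (phi x) :=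
  (T (section_through v) : C0_section F) (phi x).

(** Domination shows that (T s)(phi x) depends on s(x) only. *)
Lemma fiber_mapE (s : C0_section E) x :
  fiber_map (s x) = (T s : C0_section F) (phi x).
Proof.
apply/eqP; rewrite -subr_eq0; apply/eqP/rnorm_eq0/le_anti.
rewrite rnorm_ge0 andbT.
have := dominated_at (section_through (s x) - s) x.
by rewrite operatorB//= !scaleN1r section_throughE subrr rnorm0 mulr0.
Qed.

Lemma fiber_map_linear x : linear (@fiber_map x).
Proof.
move=> a u v; rewrite -{1}(section_throughE u) -{1}(section_throughE v).
have := fiber_mapE (a *: section_through u + section_through v) x.
by rewrite TL /= => ->.
Qed.

Lemma rnorm_fiber_map x (v : E x) : rnorm (fiber_map v) <= m * rnorm v.
Proof. by rewrite -{2}(section_throughE v); exact: dominated_at. Qed.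

Lemma fiber_map_operator x : bounded_operator (@fiber_map x).
Proof.
split; first exact: fiber_map_linear.
by exists m; exact: rnorm_fiber_map.
Qed.

(** On a vector w over y, the map is the continuous section T s of F at phi y
    plus an error of norm at most m ||w - s y||, where s is a section through
    the given vector. *)
Lemma fiber_map_continuous : continuous (total_map (E := E) (F := F) fiber_map).
Proof.
move=> [x v] W; rewrite /total_map /=.
pose s := section_through v.
have -> : fiber_map v = (T s : C0_section F) (phi x) by [].
move=> /add_near[V vV [e e0 eW]].
have em : 0 < e / m by rewrite divr_gt0.
have sV : \forall y \near x, V (in_fiber ((T s : C0_section F) (phi y))).
  exact: homeo_fun_continuous phi x _
    (sec_continuous (T s : C0_section F) _ _ vV).
have We : \forall y \near x, forall a b : F (phi y),
    V (in_fiber a) -> rnorm b <= e -> W (in_fiber (a + b)).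
  exact: homeo_fun_continuous phi x _ eW.
have := near_section s x em; rewrite section_throughE => vs.
apply: filterS3 vs (near_proj v sV) (near_proj v We).
move=> -[y w] /= ws Vy Wy.
rewrite /total_map /=.
have := Wy ((T s : C0_section F) (phi y))
  (fiber_map w - (T s : C0_section F) (phi y)) Vy.
rewrite subrKC; apply; rewrite -fiber_mapE -(operatorB (@fiber_map_linear y)).
apply: le_trans (rnorm_fiber_map _) _.
by rewrite mulrC -ler_pdivlMr// ltW.
Qed.

Lemma fiber_map_bounded :
  has_ubound [set opnorm (@fiber_map x) | x in [set: X]].
Proof.
exists m => _ [x _ <-].
exact: opnorm_le (@fiber_map_linear x) (ltW m0) (@rnorm_fiber_map x).
Qed.

Definition morphism_of_dominated : bundle_morphism phi E F :=
  BundleMorphism fiber_map_operator fiber_map_continuous fiber_map_bounded.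

Lemma morphism_of_dominatedP : induced_by T morphism_of_dominated.
Proof. by apply/induced_byP => s x; rewrite /= fiber_mapE. Qed.

End morphism_of_dominated.

Section induced.
Context (T : Gamma0 E -> Gamma0 F) (Phi : bundle_morphism phi E F).
Context (bT : bounded_operator T) (TPhi : induced_by T Phi).

Lemma induced_byE (s : C0_section E) x :
  (T s : C0_section F) (phi x) = Phi x (s x).
Proof. exact: (induced_byP T Phi).1. Qed.

Lemma induced_weighted : weighted phi T.
Proof.
move=> f s; apply: C0_section_ext => y; rewrite -(homeo_invK phi y).
have [PhiL _] := mor_operator Phi (homeo_inv phi y).
by rewrite induced_byE /= homeo_funK operatorZ// induced_byE.
Qed.

Lemma induced_unique (Psi : bundle_morphism phi E F) :
  induced_by T Psi -> Psi = Phi.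
Proof.
move=> TPsi; apply: bundle_morphism_ext => x v.
have [s <-] := enough_sections v.
by rewrite -induced_byE ((induced_byP T Psi).1 TPsi).
Qed.

Lemma opnorm_le_mor_norm x : opnorm (Phi x) <= mor_norm Phi.
Proof. by apply: ub_le_sup; [exact: mor_bounded|exists x]. Qed.

Lemma mor_norm_ge0 : 0 <= mor_norm Phi.
Proof.
by apply: sup_range_ge0 => x; exact: opnorm_ge0 (mor_operator Phi x).
Qed.

(** One inequality is domination of T by its norm, tested on a section through
    each vector; the other is the fiberwise bound along each section. *)
Lemma induced_norm : mor_norm Phi = opnorm T.
Proof.
have T0 := opnorm_ge0 bT; have [TL _] := bT.
apply/le_anti/andP; split.
  have [e|ne] := pselect ([set opnorm (Phi x) | x in [set: X]] = set0).
    by rewrite /mor_norm e sup0.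
  apply: ge_sup; first exact/set0P/eqP.
  move=> _ [x _ <-]; have [PhiL _] := mor_operator Phi x.
  apply: opnorm_le => // v; have [s <-] := enough_sections v.
  rewrite -induced_byE.
  have := support_decreasing_dominated bT
    (weighted_support_decreasing bT induced_weighted) s (phi x).
  by rewrite /= homeo_funK.
apply: opnorm_le => //; first exact: mor_norm_ge0.
move=> s; apply: le_um_norm => [|y].
  by rewrite mulr_ge0 ?rnorm_ge0// mor_norm_ge0.
rewrite -(homeo_invK phi y); set x := homeo_inv phi y.
change (rnorm ((T s : C0_section F) (phi x)) <= mor_norm Phi * rnorm s).
rewrite induced_byE; apply: le_trans (rnorm_operator _ (mor_operator Phi x)) _.
rewrite ler_pM ?rnorm_ge0 ?opnorm_le_mor_norm//.
  exact: opnorm_ge0 (mor_operator Phi x).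
exact: (um_norm_le (M := Gamma0 E)).
Qed.

Lemma induced_isometric : mor_isometric Phi <-> isometric T.
Proof.
split=> [Phi_iso s|T_iso x v].
  have pointwise x : um_norm (T s) (phi x) = um_norm s x.
    by rewrite [LHS]/= /sec_pointwise_norm induced_byE Phi_iso.
  apply/le_anti/andP; split; apply: le_um_norm (rnorm_ge0 _) _ => x.
    by rewrite -(homeo_invK phi x) pointwise um_norm_le.
  by rewrite -pointwise um_norm_le.
have [s <-] := enough_sections v; rewrite -induced_byE.
apply/le_anti/andP; split.
  exact: weighted_isometric_le induced_weighted T_iso.
exact: weighted_isometric_ge induced_weighted T_iso.
Qed.

End induced.

End bundle_case.

(** * The equivalence *)

Theorem theorem5p5 (R : realType) (k : scalar_kind) (Omega : lchType)
  (phi : homeomorphism Omega Omega) :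
  (forall (Gamma Lambda : U0_normed_module R k Omega) (T : Gamma -> Lambda),
    bounded_operator T ->
    [<-> (* (a) *) forall f s,
           T (bm_act f s) = bm_act (C0_transport phi f) (T s);
         (* (b) *) forall s, supp (T s) `<=` phi @` supp s;
         (* (c) *) forall s x,
           um_norm (T s) x <= opnorm T * (um_norm s \o homeo_inv phi) x;
         (* (d) *) exists2 m : R, 0 < m & forall s x,
           um_norm (T s) x <= m * (um_norm s \o homeo_inv phi) x])
  /\
  (forall (E F : banach_bundle (R := R) (k := k) Omega)
      (T : Gamma0 E -> Gamma0 F),
    bounded_operator T ->
    [<-> (* (a) *) forall f s,
           T (bm_act f s) = bm_act (C0_transport phi f) (T s);
         (* (b) *) forall s, supp (T s) `<=` phi @` supp s;
         (* (c) *) forall s x,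
           um_norm (T s) x <= opnorm T * (um_norm s \o homeo_inv phi) x;
         (* (d) *) exists2 m : R, 0 < m & forall s x,
           um_norm (T s) x <= m * (um_norm s \o homeo_inv phi) x;
         (* (e) *) exists Phi : bundle_morphism phi E F, induced_by T Phi]
    /\ forall Phi : bundle_morphism phi E F, induced_by T Phi ->
       [/\ forall Psi : bundle_morphism phi E F, induced_by T Psi -> Psi = Phi,
           mor_norm Phi = opnorm T &
           mor_isometric Phi <-> isometric T]).
Proof.
split=> [Gamma Lambda T bT|E F T bT].
  tfae.
  - exact: weighted_support_decreasing.
  - exact: support_decreasing_dominated.
  - exact: dominated_pos (opnorm_ge0 bT).
  - by move=> [m _]; exact: dominated_weighted.
split.
  tfae.
  - exact: weighted_support_decreasing.
  - exact: support_decreasing_dominated.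
  - exact: dominated_pos (opnorm_ge0 bT).
  - have [TL _] := bT; move=> [m m0 Tm].
    by exists (morphism_of_dominated TL m0 Tm); exact: morphism_of_dominatedP.
  - by move=> [Phi]; exact: induced_weighted.
move=> Phi TPhi; split.
- exact: induced_unique.
- exact: induced_norm.
- exact: induced_isometric.
Qed.
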